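(* Let $n,\kappa_g,\delta,g$ be integers with $g\ge 0$ and $n\ge\kappa_g+2(g+1)$. Let $\mathcal{G}_n^{\kappa_g,\delta}$ be the set of simple connected graphs of order $n$ with minimum degree $\delta$ and $g$-good neighbor connectivity $\kappa_g(G)=\kappa_g$, and let $G\in\mathcal{G}_n^{\kappa_g,\delta}$. Let $\rho(\cdot)$ denote the adjacency spectral radius. Then the following statements hold. (I) If $\kappa_g>\delta$ and $\delta<g$, then $\rho(G)\le\rho(G_{n,g+1}^{\delta,0})$, with equality if and only if $G\cong G_{n,g+1}^{\delta,0}$. (II) If $\kappa_g>\delta\ge g$, then $\rho(G)\le\rho(G_{n,g+1}^{\delta-g,g})$, with equality if and only if $G\cong G_{n,g+1}^{\delta-g,g}$. (III) If $2\le\kappa_g\le\delta<g$, then $\rho(G)\le\rho(G_{n,g+1}^{\kappa_g-1,\delta-\kappa_g+1})$, with equality if and only if $G\cong G_{n,g+1}^{\kappa_g-1,\delta-\kappa_g+1}$. (IV) If $1=\kappa_g\le\delta<g$, then $\rho(G)\le\rho(G_{n,g+1}^{0,\delta})$, with equality if and only if $G\cong G_{n,g+1}^{0,\delta}$. (V) If $\kappa_g\le\delta$ and $g\le\delta<g+\kappa_g$, then $\rho(G)\le\rho(G_{n,g+1}^{\delta-g,g})$, with equality if and only if $G\cong G_{n,g+1}^{\delta-g,g}$. (VI) If $\delta\ge g+\kappa_g$, then $\rho(G)\le\rho\big(K_{\kappa_g}\vee(K_{n-\delta-1}\cup K_{\delta-\kappa_g+1})\big)$, with equality if and only if $G\cong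 K_{\kappa_g}\vee(K_{n-\delta-1}\cup K_{\delta-\kappa_g+1})$.
   Context: All graphs are finite, simple and connected (except for intermediate graphs in constructions). The spectral radius $\rho(G)$ is the largest eigenvalue of the adjacency matrix $A(G)$. $K_m$ is the complete graph on $m$ vertices ($K_0$ is the empty graph), $G_1\cup G_2$ is the disjoint union, and the join $G_1\vee G_2$ is obtained from $G_1\cup G_2$ by adding all edges between a vertex of $G_1$ and a vertex of $G_2$. A subset $F\subseteq V(G)$ is a $g$-good neighbor cut of $G$ if $G-F$ is disconnected and each vertex $v\in V(G)\setminus F$ has at least $g$ neighbors in $G-F$. The $g$-good neighbor connectivity $\kappa_g(G)$ is the minimum cardinality of a $g$-good neighbor cut of $G$ (the statement that $\kappa_g(G)$ equals a given value includes that such a cut exists). The symbol $\kappa_g$ without argument denotes a fixed integer, the prescribed value of $\kappa_g(G)$. The graphs in the claim (each on $n$ vertices) are defined as follows; in each, edges added from the isolated vertex $K_1$ go to distinct vertices. - $G_{n,g+1}^{\delta,0}$: obtained from $K_1\cup\big(K_{\kappa_g-1}\vee(K_{n-g-1-\kappa_g}\cup K_{g+1})\big)$ by adding $\delta$ edges between the isolated vertex $K_1$ and $K_{\kappa_g-1}$. - $G_{n,g+1}^{\delta-g,g}$: obtained from $K_1\cup\big(K_{\kappa_g}\vee(K_{n-g-1-\kappa_g}\cup K_g)\big)$ by adding $\delta-g$ edges between the isolated vertex $K_1$ and $K_{\kappa_g}$, and adding $g$ edges between $K_1$ and $K_g$ (so $K_1$ is joined to every vertex of $K_g$). - $G_{n,g+1}^{\kappa_g-1,\delta-\kappa_g+1}$: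 obtained from $K_1\cup\big(K_{\kappa_g-1}\vee(K_{n-g-1-\kappa_g}\cup K_{g+1})\big)$ by adding $\kappa_g-1$ edges between the isolated vertex $K_1$ and $K_{\kappa_g-1}$ (so $K_1$ is joined to every vertex of $K_{\kappa_g-1}$), and adding $\delta-\kappa_g+1$ edges between $K_1$ and $K_{n-g-1-\kappa_g}$. - $G_{n,g+1}^{0,\delta}$: obtained from $K_1\cup(K_{n-g-2}\cup K_{g+1})$ by adding $\delta-1$ edges between the isolated vertex $K_1$ and $K_{n-g-2}$, and adding one edge between $K_1$ and $K_{g+1}$. *)

(* Defs.v *)
From HB Require Import structures.
From mathcomp Require Import all_boot all_order all_algebra.
From mathcomp Require Import mathcomp_extra boolp classical_sets reals.
From mathcomp Require Import complex.

Set Implicit Arguments.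
Unset Strict Implicit.
Unset Printing Implicit Defensive.

Import Order.TTheory GRing.Theory Num.Theory.

Record sgraph := SGraph {
  vertex :> finType;
  adj : rel vertex;
  adj_sym : symmetric adj;
  adj_irr : irreflexive adj
}.
Arguments adj {s} : rename.

Definition deg (G : sgraph) (v : G) : nat := #|[set w | adj v w]|.

(* The graph without vertices is connected in this sense, so a non-connected
   graph has at least two vertices. *)
Definition connected (G : sgraph) : Prop :=
  forall x y : G, connect adj x y.

Definition is_min_degree (G : sgraph) (d : nat) : Prop :=
  (exists v : G, deg v = d) /\ (forall v : G, d <= deg v).

Definition isomorphic (G H : sgraph) : Prop :=
  exists f : G -> H, bijective f /\ (forall x y, adj (f x) (f y) = adj x y).

Section Deletion.
Variables (G : sgraph) (F : {set G}).

Definition delete_adj : rel {x : G | x \notin F} :=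
  fun x y => adj (val x) (val y).

Lemma delete_sym : symmetric delete_adj.
Proof. by move=> x y; apply: adj_sym. Qed.

Lemma delete_irr : irreflexive delete_adj.
Proof. by move=> x; apply: adj_irr. Qed.

Definition delete : sgraph := SGraph delete_sym delete_irr.
End Deletion.

Definition good_neighbor_cut (g : nat) (G : sgraph) (F : {set G}) : Prop :=
  ~ connected (delete F) /\ (forall v : delete F, g <= deg v).

Definition is_good_neighbor_connectivity (g : nat) (G : sgraph) (k : nat) :
    Prop :=
  (exists F : {set G}, good_neighbor_cut g F /\ #|F| = k) /\
  (forall F : {set G}, good_neighbor_cut g F -> k <= #|F|).

Definition graph_class (n kappa delta g : nat) (G : sgraph) : Prop :=
  [/\ #|vertex G| = n, connected G, is_min_degree G delta
    & is_good_neighbor_connectivity g G kappa].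

Section Complete.
Variable m : nat.

Lemma complete_sym : symmetric (fun i j : 'I_m => i != j).
Proof. by move=> i j; rewrite eq_sym. Qed.

Lemma complete_irr : irreflexive (fun i j : 'I_m => i != j).
Proof. by move=> i; rewrite eqxx. Qed.

Definition complete : sgraph := SGraph complete_sym complete_irr.
End Complete.

Section UnionJoin.
Variables G H : sgraph.

Definition sum_adj (cross : bool) : rel (G + H)%type := fun x y =>
  match x, y with
  | inl a, inl b => adj a b
  | inr a, inr b => adj a b
  | _, _ => cross
  end.

Lemma sum_sym cross : symmetric (sum_adj cross).
Proof. by move=> [a|a] [b|b] //=; apply: adj_sym. Qed.

Lemma sum_irr cross : irreflexive (sum_adj cross).
Proof. by move=> [a|a] /=; apply: adj_irr. Qed.

Definition dunion : sgraph := SGraph (sum_sym false) (sum_irr false).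
Definition join : sgraph := SGraph (sum_sym true) (sum_irr true).
End UnionJoin.

Section AddEdges.
Variables (G : sgraph) (E : rel G).

Definition add_edges_adj : rel G :=
  fun x y => adj x y || (x != y) && (E x y || E y x).

Lemma add_edges_sym : symmetric add_edges_adj.
Proof.
by move=> x y; rewrite /add_edges_adj adj_sym eq_sym (orbC (E x y)).
Qed.

Lemma add_edges_irr : irreflexive add_edges_adj.
Proof. by move=> x; rewrite /add_edges_adj adj_irr eqxx. Qed.

Definition add_edges : sgraph := SGraph add_edges_sym add_edges_irr.
End AddEdges.

(* The graphs G_{n,g+1}^{p,q}, with (p, q) = (delta, 0), (delta - g, g),
   (kappa - 1, delta - kappa + 1) and (0, delta).  The k edges from the isolated
   vertex to a clique go to its k vertices of smallest index; another choice of
   k distinct vertices gives an isomorphic graph.  The truncated subtractions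
   are exact under the hypotheses for which each graph is used. *)

Definition graph_delta_0 (n kappa delta g : nat) : sgraph :=
  @add_edges
    (dunion (complete 1)
       (join (complete (kappa - 1))
          (dunion (complete (n - g - 1 - kappa)) (complete (g + 1)))))
    (fun x y => match x, y with
                | inl _, inr (inl i) => i < delta
                | _, _ => false
                end).

Definition graph_deltag_g (n kappa delta g : nat) : sgraph :=
  @add_edges
    (dunion (complete 1)
       (join (complete kappa)
          (dunion (complete (n - g - 1 - kappa)) (complete g))))
    (fun x y => match x, y with
                | inl _, inr (inl i) => i < delta - g
                | inl _, inr (inr (inr i)) => i < g
                | _, _ => false
                end).

Definition graph_kappa1_deltakappa (n kappa delta g : nat) : sgraph :=
  @add_edges
    (dunion (complete 1)
       (join (complete (kappa - 1))
          (dunion (complete (n - g - 1 - kappa)) (complete (g + 1)))))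
    (fun x y => match x, y with
                | inl _, inr (inl i) => i < kappa - 1
                | inl _, inr (inr (inl i)) => i < delta - kappa + 1
                | _, _ => false
                end).

Definition graph_0_delta (n delta g : nat) : sgraph :=
  @add_edges
    (dunion (complete 1)
       (dunion (complete (n - g - 2)) (complete (g + 1))))
    (fun x y => match x, y with
                | inl _, inr (inl i) => i < delta - 1
                | inl _, inr (inr i) => i < 1
                | _, _ => false
                end).

Definition graph_large_delta (n kappa delta : nat) : sgraph :=
  join (complete kappa)
    (dunion (complete (n - delta - 1)) (complete (delta - kappa + 1))).

Local Open Scope ring_scope.

Definition adjmx (R : realType) (G : sgraph) : 'M[R]_#|vertex G| :=
  \matrix_(i, j) (adj (enum_val i) (enum_val j))%:R.

Definition spectral_radius (R : realType) (G : sgraph) : R :=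
  sup [set x : R | eigenvalue (adjmx R G) x]%classic.

Lemma symmetric_has_eigenvalue (R : rcfType) n (A : 'M[R]_n) :
  (0 < n)%N -> A^T = A -> exists a, eigenvalue A a.
Proof.
move=> n0 sA; pose f := real_complex R.
have [c cE] := eigenvalue_closed (map_mx f A) n0.
have [v vE v0] := eigenvalueP cE.
have AJ : map_mx Num.conj (map_mx f A)^T = map_mx f A.
  rewrite map_trmx sA; apply/matrixP=> i j; rewrite !mxE.
  by apply/CrealP; rewrite complex_real.
have d0 : dotmx v v != 0 by rewrite dnorm_eq0.
have E1 : (v *m map_mx f A *m map_mx Num.conj v^T) 0 0 = c * dotmx v v.
  by rewrite vE -scalemxAl mxE -dotmxE.
have E2 : (v *m map_mx f A *m map_mx Num.conj v^T) 0 0 = c^* * dotmx v v.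
  rewrite -{1}AJ -mulmxA -map_mxM -trmx_mul vE linearZ /= map_mxZ -scalemxAr mxE.
  by rewrite dotmxE.
have cr : c^* = c by apply: (mulIf d0); rewrite -E1 -E2.
exists (complex.Re c); rewrite -(@eigenvalue_map _ _ f) /f /=.
by rewrite RRe_real //; apply/CrealP.
Qed.

Lemma eigenvalue_seq (F : fieldType) n (A : 'M[F]_n) :
  exists s : seq F, forall x, eigenvalue A x = (x \in s).
Proof.
suff H (p : {poly F}) :
    p != 0 -> exists s : seq F, forall x, root p x = (x \in s).
  have [|s sE] := H (char_poly A); first by apply/monic_neq0/char_poly_monic.
  by exists s => x; rewrite eigenvalue_root_char.
have [m] := ubnP (size p); elim: m p => // m IH p sp p0.
have [[x px]|nx] := pselect (exists x, root p x); last first.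
  by exists [::] => x; apply/negbTE/negP => ?; apply: nx; exists x.
move: px => /factor_theorem [q qE].
have q0 : q != 0 by apply: contraNneq p0 => q0; rewrite qE q0 mul0r.
have [|//|s sE] := IH q.
  by move: sp; rewrite qE size_Mmonic ?monicXsubC // size_XsubC addn2 /= ltnS.
by exists (x :: s) => y; rewrite qE rootM root_XsubC sE inE orbC.
Qed.

Lemma spectral_radius_max (R : realType) (G : sgraph) : (0 < #|vertex G|)%N ->
  eigenvalue (adjmx R G) (spectral_radius R G) /\
  forall x, eigenvalue (adjmx R G) x -> x <= spectral_radius R G.
Proof.
move=> n0; have [|a aE] := @symmetric_has_eigenvalue R _ (adjmx R G) n0.
  by apply/matrixP=> i j; rewrite !mxE adj_sym.
have [s sE] := eigenvalue_seq (adjmx R G).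
pose m := \big[Num.max/a]_(x <- s) x.
have mub x : x \in s -> x <= m by move=> xs;
    apply: (@unstable.le_bigmax_seq _ _ a _ s x xpredT id xs).
have mE : eigenvalue (adjmx R G) m.
  rewrite /m big_seq; elim/big_ind: _ => // [x y|x]; last by rewrite sE.
  by rewrite /Num.max; case: ifP.
suff -> : spectral_radius R G = m by split=> // x; rewrite sE; apply: mub.
apply/le_anti/andP; split.
  by apply: ge_sup; [exists m | move=> x /=; rewrite sE; apply: mub].
apply: ub_le_sup => //; exists m => x /=; rewrite sE; exact: mub.
Qed.

Definition rho_extremal (R : realType) (G H : sgraph) : Prop :=
  spectral_radius R G <= spectral_radius R H /\
  (spectral_radius R G = spectral_radius R H <-> isomorphic G H).

(* Main.v *)
From HB Require Import structures.
Require Import Defs.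
From mathcomp Require Import all_boot all_order all_algebra.
From mathcomp Require Import reals complex ring lra zify.
From mathcomp Require boolp.

(* Let F be a minimum cut and C1, C2 a splitting of G - F into two parts without
   edges between them, and let v be a vertex of minimum degree.  Adding all
   edges that are compatible with (F, C1, C2) and with the neighbourhood of v,
   we may assume that the only nonadjacent pairs are those in C1 x C2 and those
   containing v.  The Perron vector x of G is kept, and the vertices are
   redistributed: they are sorted by decreasing weight, and the roles of F, of
   the large part, of the small part and of the neighbours of v are given to
   segments of this order.  The result is the claimed extremal graph, and its
   quadratic form at x is at least that of G, so the Rayleigh principle bounds
   the spectral radius.  In case of equality x is an eigenvector of the extremal
   graph; its eigen-equations strictly separate the weights of the different
   classes, which forces the redistribution to preserve the classes.
     When v lies in F and g <= delta, the graph obtained in this way is not yet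
   the extremal one; a further move which exchanges the roles of v and of
   a vertex of the small part strictly increases the spectral radius.  In (VI)
   the role of v is played by any vertex of F, joined to all other vertices. *)

Set Implicit Arguments.
Unset Strict Implicit.
Unset Printing Implicit Defensive.

Import Order.TTheory GRing.Theory Num.Theory.

Local Open Scope ring_scope.

(** * Rayleigh quotients and Perron vectors *)

Section Rayleigh.
Local Open Scope sesquilinear_scope.

(** At a fixed vector, comparing two graphs on one vertex set means comparing their nonadjacent
    pairs: [wt A * wt B], plus [x r] times the weight of the non-neighbours of [r]. The product is
    controlled by the identity [s1 s2 - a b = (s1 - b)(s2 - b) + b (s1 + s2 - a - b)]: it suffices
    that the new small part is no heavier than either old side and that the new core is no lighter
    than the old one, which is what sorting provides. In case of equality each summand must vanish.
    One obstacle is that the two sides of the cut need not be separated: if they have equal weight,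
    the eigen-equations do not distinguish their vertices. Hence the sides are recovered only
    through cardinalities: the numbers of neighbours and non-neighbours of the special vertex in the
    core and on each side determine the graph up to isomorphism. The other obstacle is in the strict
    move: the special vertex gives up neighbours in the core, which may be heavier than the vertices
    that compensate for them. The clique on the [g + 1] vertices of the small part makes the
    spectral radius at least [g], and this bounds the excess. *)

Lemma symmetric_rayleigh (R : rcfType) n (A : 'M[R]_n) (r : R) :
  A^T = A -> (forall a, eigenvalue A a -> a <= r) ->
  forall x : 'rV_n, (x *m A *m x^T) 0 0 <= r * (x *m x^T) 0 0.
Proof.
(* Over [R[i]] the matrix is Hermitian, hence unitarily diagonalizable. The diagonal entries are
   real and are eigenvalues of [A], so each is at most [r]; in the coordinates [w] the inequality
   holds term by term. *)
move=> sA Ar x; pose f := real_complex R.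
have fR z : f z \is Num.real by rewrite complex_real.
pose B := map_mx f A; pose u := map_mx f x.
have uE : u ^t* = map_mx f x^T.
  by apply/matrixP => i j; rewrite !mxE; apply/CrealP/fR.
have hB : B \is hermsymmx.
  apply: realsym_hermsym; last by apply/mxOverP => i j; rewrite mxE fR.
  by apply/is_hermitianmxP; rewrite expr0 scale1r map_mx_id // map_trmx sA.
have nB := orthomx_spectralP (hermitian_normalmx hB).
have Preal := hermitian_spectral_diag_real hB.
have Punit := spectral_unitarymx B.
move: nB Preal Punit; set P := spectralmx B; set d := spectral_diag B.
move=> BE dR Pu.
have PP : P *m P ^t* = 1%:M by apply/unitarymxP.
have Pi : invmx P = P ^t* by rewrite invmx_unitary.
have P'P : P ^t* *m P = 1%:M by rewrite -Pi mulVmx // unitarymx_unit.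
pose w := u *m P ^t*.
have wE : w ^t* = P *m u ^t* by rewrite trmx_mul map_mxM trmxCK.
have dE i : exists2 a, d 0 i = f a & a <= r.
  exists (complex.Re (d 0 i)).
    by rewrite /f /= RRe_real //; apply: (mxOverP dR).
  apply: Ar; rewrite -(@eigenvalue_map _ _ f) /f /= RRe_real; last first.
    by apply: (mxOverP dR).
  apply/eigenvalueP; exists (row i P).
    rewrite -/f -/B BE Pi !mulmxA -row_mul PP row1 rowE.
    by rewrite -!rowE row_diag_mx -scalemxAl -rowE.
  (* A zero row of [P] would make a diagonal entry of [P *m P ^t*] vanish instead of being 1. *)
  apply: contra_neq (oner_neq0 R[i]) => Pi0.
  have := congr1 (fun M : 'M_n => M i i) PP; rewrite !mxE eqxx mulr1n => <-.
  rewrite big1 // => j _; move/rowP/(_ j): Pi0; rewrite !mxE => ->.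
  by rewrite mul0r.
rewrite -(lecR) rmorphM /=.
have -> : ((x *m A *m x^T) 0 0)%:C%C = (u *m B *m u ^t*) 0 0.
  by rewrite uE -!map_mxM [RHS]mxE.
have -> : ((x *m x^T) 0 0)%:C%C = (w *m w ^t*) 0 0.
  by rewrite wE /w !mulmxA -(mulmxA u) P'P mulmx1 uE -map_mxM [RHS]mxE.
have -> : u *m B *m u ^t* = w *m diag_mx d *m w ^t*.
  by rewrite wE /w BE Pi !mulmxA.
rewrite !mxE mulr_sumr; apply: ler_sum => i _.
rewrite mul_mx_diag !mxE -mulrA [d 0 i * _]mulrC mulrA [X in X <= _]mulrC.
have [a -> ar] := dE i.
by apply: ler_wpM2r; rewrite ?mul_conjC_ge0 // lecR.
Qed.
End Rayleigh.

(** For small positive [t] the linear term wins; [t = s / (|c| + 1)] is small enough whatever the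
    sign of [c]. *)
Lemma linear_le_quadratic_eq0 (R : realFieldType) (s c : R) : 0 <= s ->
  (forall t, t *+ 2 * s <= t ^+ 2 * c) -> s = 0.
Proof.
move=> s0 key; apply/le_anti; rewrite s0 andbT leNgt; apply/negP => s1.
have c1 : 0 < `|c| + 1 by rewrite ltr_wpDl.
pose q := s / (`|c| + 1).
have sE : s = q * (`|c| + 1) by rewrite /q divfK // gt_eqF.
have q0 : 0 < q by rewrite divr_gt0.
have := key q; rewrite leNgt => /negP; apply;
  rewrite [X in _ *+ 2 * X]sE -subr_gt0.
have -> : q *+ 2 * (q * (`|c| + 1)) - q ^+ 2 * c =
  q ^+ 2 * ((`|c| + 1) *+ 2 - c) by clear; ring.
by apply: mulr_gt0; [exact: exprn_gt0 | have := ler_norm c; lra].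
Qed.

Section GraphSpectrum.
Variable R : realType.

Definition quad (H : sgraph) (x : H -> R) : R :=
  \sum_u \sum_v (adj u v)%:R * (x u * x v).

Definition eigenvec (H : sgraph) (r : R) (x : H -> R) : Prop :=
  forall u, \sum_v (adj u v)%:R * x v = r * x u.

Lemma eigenvalue_adjmxP (H : sgraph) (a : R) :
  eigenvalue (adjmx R H) a <->
  exists2 x : H -> R, eigenvec a x & exists u, x u != 0.
Proof.
split=> [/eigenvalueP [v vE v0]|[x xE [u xu]]].
  exists (fun u => v 0 (enum_rank u)) => [u|].
    have := congr1 (fun M : 'rV_ _ => M 0 (enum_rank u)) vE.
    rewrite !mxE => <-.
    rewrite (reindex _ (onW_bij _ (enum_val_bij H))) /=.
    by apply: eq_bigr => i _; rewrite !mxE enum_valK enum_rankK mulrC adj_sym.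
  apply: boolp.contrapT => nx; move/eqP: v0; apply; apply/rowP => i;
    rewrite mxE.
  apply/eqP; apply: boolp.contrapT => vi; apply: nx; exists (enum_val i).
  by rewrite enum_valK; apply/negP.
apply/eigenvalueP; exists (\row_i x (enum_val i)).
  apply/rowP => i; rewrite !mxE -xE.
  rewrite [RHS](reindex _ (onW_bij _ (enum_val_bij H))) /=.
  by apply: eq_bigr => j _; rewrite !mxE mulrC adj_sym.
apply: contra_neq xu => /rowP /(_ (enum_rank u)).
by rewrite !mxE enum_rankK.
Qed.

Lemma spectral_radius_eigenvec (H : sgraph) : (0 < #|H|)%N ->
  exists2 x : H -> R, eigenvec (spectral_radius R H) x & exists u, x u != 0.
Proof. by move=> /(@spectral_radius_max R) [/eigenvalue_adjmxP]. Qed.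

Lemma rayleigh (H : sgraph) (x : H -> R) : (0 < #|H|)%N ->
  quad x <= spectral_radius R H * \sum_u x u ^+ 2.
Proof.
move=> H0; have [_ Hmax] := spectral_radius_max R H0.
have sA : (adjmx R H)^T = adjmx R H.
  by apply/matrixP => i j; rewrite !mxE adj_sym.
have := symmetric_rayleigh sA Hmax (\row_i x (enum_val i)).
congr (_ <= _ * _).
  rewrite /quad mxE (reindex _ (onW_bij _ (enum_val_bij H))) /=.
  under [RHS]eq_bigr => i _ do
    rewrite (reindex _ (onW_bij _ (enum_val_bij H))) /=.
  rewrite exchange_big /=; apply: eq_bigr => i _; rewrite !mxE big_distrl.
  by apply: eq_bigr => j _; rewrite !mxE /=; ring.
rewrite mxE (reindex _ (onW_bij _ (enum_val_bij H))) /=.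
by apply: eq_bigr => i _; rewrite !mxE expr2.
Qed.

Lemma eigenvec_quad (H : sgraph) r (x : H -> R) :
  eigenvec r x -> quad x = r * \sum_u x u ^+ 2.
Proof.
move=> xE; rewrite /quad mulr_sumr; apply: eq_bigr => u _.
rewrite expr2 mulrA -xE mulr_suml; apply: eq_bigr => v _; ring.
Qed.

(* The form [r |x|^2 - quad x] is nonnegative, hence a zero of it is a
   critical point. *)
Lemma rayleigh_eq (H : sgraph) (x : H -> R) : (0 < #|H|)%N ->
  spectral_radius R H * \sum_u x u ^+ 2 <= quad x ->
  eigenvec (spectral_radius R H) x.
Proof.
move=> H0; set r := spectral_radius R H => xE.
have xE' : quad x = r * \sum_u x u ^+ 2.
  by apply/le_anti; rewrite xE rayleigh.
(* The perturbation goes along the residual [A x - r x], because then the first-order term is [2 t]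
   times the squared norm of this residual, which is therefore forced to be zero. *)
pose y u := \sum_v (adj u v)%:R * x v - r * x u.
have quadD t : quad (fun u => x u + t * y u) =
    quad x + (t *+ 2) * (\sum_u y u * \sum_v (adj u v)%:R * x v)
           + t ^+ 2 * quad y.
  have -> : (t *+ 2) * (\sum_u y u * \sum_v (adj u v)%:R * x v) =
     \sum_u \sum_v ((adj u v)%:R * (x u * (t * y v))
       + (adj u v)%:R * (x v * (t * y u))).
    under [RHS]eq_bigr do rewrite big_split /=.
    rewrite big_split /= [X in X + _]exchange_big /= -big_split /= mulr_sumr.
    apply: eq_bigr => u _; rewrite mulrA mulr_sumr -big_split /=.
    by apply: eq_bigr => v _; rewrite (adj_sym v u); ring.
  rewrite /quad mulr_sumr -!big_split /=; apply: eq_bigr => u _.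
  rewrite mulr_sumr -!big_split /=; apply: eq_bigr => v _; ring.
have normD t : \sum_u (x u + t * y u) ^+ 2 =
    \sum_u x u ^+ 2 + (t *+ 2) * (\sum_u y u * x u) + t ^+ 2 * \sum_u y u ^+ 2.
  rewrite !mulr_sumr -!big_split /=; apply: eq_bigr => u _; ring.
pose s := \sum_u y u ^+ 2.
have sE : \sum_u y u * (\sum_v (adj u v)%:R * x v) - r * (\sum_u y u * x u) = s.
  rewrite mulr_sumr -sumrN -big_split /=; apply: eq_bigr => u _.
  by rewrite /y; ring.
have aux (N M Y q p t : R) :
    r * N + t *+ 2 * Y + t ^+ 2 * q <= r * (N + t *+ 2 * M + t ^+ 2 * p) ->
    Y = p + r * M -> t *+ 2 * p <= t ^+ 2 * (r * p - q).
  by move=> + YE; rewrite YE; move: (r) => r'; clear; lra.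
have key t : t *+ 2 * s <= t ^+ 2 * (r * s - quad y).
  have := rayleigh (fun u => x u + t * y u) H0; rewrite quadD normD xE' -/r -/s.
  by move=> /aux; apply; apply/eqP; rewrite -subr_eq sE.
have s0 : 0 <= s by apply: sumr_ge0 => u _; apply: sqr_ge0.
have /eqP := linear_le_quadratic_eq0 s0 key.
rewrite psumr_eq0 => [/allP yE u|u _]; last exact: sqr_ge0.
by have := yE u (mem_index_enum u); rewrite sqrf_eq0 subr_eq0 => /eqP.
Qed.

(** Taking absolute values keeps the norm and does not decrease the quadratic form, so the result
    still attains the Rayleigh bound and is again an eigenvector. *)
Lemma perron (H : sgraph) : (0 < #|H|)%N ->
  exists x : H -> R, [/\ eigenvec (spectral_radius R H) x,
    forall u, 0 <= x u & exists u, x u != 0].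
Proof.
move=> H0; have [x xE [u xu]] := spectral_radius_eigenvec H0.
exists (fun u => `|x u|); split=> //; last by exists u; rewrite normr_eq0.
apply: rayleigh_eq => //.
under eq_bigr do rewrite real_normK ?num_real //.
rewrite -(eigenvec_quad xE); apply: ler_sum => v _; apply: ler_sum => w _.
by rewrite -normrM ler_wpM2l // ler_norm.
Qed.

Lemma spectral_radius_ge0 (H : sgraph) : (0 < #|H|)%N ->
  0 <= spectral_radius R H.
Proof.
move=> H0; have [x [xE x0 [u xu]]] := perron H0.
have : 0 <= spectral_radius R H * x u.
  by rewrite -xE sumr_ge0 // => v _; rewrite mulr_ge0.
by rewrite pmulr_lge0 // lt_def xu x0.
Qed.

(** The eigen-equation at a zero of a nonnegative [x] makes [x] vanish on all neighbours, so in a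
    connected graph a single zero would spread everywhere. *)
Lemma eigenvec_gt0 (H : sgraph) r (x : H -> R) : connected H ->
  eigenvec r x -> (forall u, 0 <= x u) -> (exists u, x u != 0) ->
  forall u, 0 < x u.
Proof.
move=> cH xE x0 [w xw] u; rewrite lt_def x0 andbT.
apply: contra xw => /eqP xu.
have: connect adj u w by apply: cH.
move=> /connectP [p pP ->]; elim: p u xu pP => [|v p IH] u xu /=;
  first by rewrite xu.
move=> /andP [uv]; apply: IH.
have := xE u; rewrite xu mulr0 => /eqP.
rewrite psumr_eq0 => [/allP /(_ v (mem_index_enum v))|z _]; last first.
  by rewrite mulr_ge0.
by rewrite uv mul1r => /eqP.
Qed.

Lemma isomorphic_spectral_radius (G H : sgraph) : isomorphic G H ->
  spectral_radius R G = spectral_radius R H.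
Proof.
move=> [f [fb fE]]; congr sup; rewrite boolp.predeqE => a /=.
have [h fK hK] := fb.
suff [P1 P2] : (eigenvalue (adjmx R G) a -> eigenvalue (adjmx R H) a) /\
  (eigenvalue (adjmx R H) a -> eigenvalue (adjmx R G) a) by split.
rewrite !eigenvalue_adjmxP; split=> [] [x xE [u xu]].
  exists (x \o h) => [v|]; last by exists (f u); rewrite /= fK.
  rewrite /= -xE (reindex f (onW_bij _ fb)); apply: eq_bigr => w _ /=.
  by rewrite fK -{1}(hK v) fE.
exists (x \o f) => [v|]; last by exists (h u); rewrite /= hK.
rewrite /= -xE [RHS](reindex f (onW_bij _ fb)); apply: eq_bigr => w _ /=.
by rewrite fE.
Qed.

End GraphSpectrum.

(** * Weights of sets of vertices *)

Section Weights.
Variables (R : realFieldType) (V : finType) (x : V -> R).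
Implicit Types P Q : {set V}.

Definition wt P : R := \sum_(u in P) x u.

Lemma wt_setID P Q : wt P = wt (P :&: Q) + wt (P :\: Q).
Proof. exact: big_setID. Qed.

Lemma wtU P Q : [disjoint P & Q] -> wt (P :|: Q) = wt P + wt Q.
Proof. by move=> dPQ; rewrite /wt -bigU //; apply: eq_bigl => u;
  rewrite !inE. Qed.

Lemma wtU1 u P : u \notin P -> wt (u |: P) = x u + wt P.
Proof. exact: big_setU1. Qed.

Lemma wtD1 u P : u \in P -> wt P = x u + wt (P :\ u).
Proof. exact: big_setD1. Qed.

Lemma wt_ge0 P : (forall u, u \in P -> 0 <= x u) -> 0 <= wt P.
Proof. exact: sumr_ge0. Qed.

Lemma wt_gt0 P : (forall u, u \in P -> 0 < x u) -> (0 < #|P|)%N -> 0 < wt P.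
Proof.
move=> x0 /card_gt0P [u uP]; rewrite (wtD1 uP) ltr_pwDl ?x0 // wt_ge0 // => v.
by rewrite !inE => /andP [_ /x0 /ltW].
Qed.

Lemma wt_bounds P t : (forall u, u \in P -> x u <= t) -> wt P <= t *+ #|P|.
Proof. by move=> xt; rewrite -sumr_const; apply: ler_sum. Qed.

Lemma wt_lbounds P t : (forall u, u \in P -> t <= x u) -> t *+ #|P| <= wt P.
Proof. by move=> xt; rewrite -sumr_const; apply: ler_sum. Qed.

Lemma card_setD_le P Q : (#|Q| <= #|P|)%N -> (#|Q :\: P| <= #|P :\: Q|)%N.
Proof.
by rewrite -(cardsID P Q) -(cardsID Q P) (setIC P Q) leq_add2l.
Qed.

(** The common part cancels. The lightest element of [P :\: Q] is a threshold between the two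
    differences, and [P :\: Q] has at least as many elements. *)
Lemma wt_le_sep P Q :
  (forall p q, p \in P -> p \notin Q -> q \in Q -> q \notin P -> x q <= x p) ->
  (forall p, p \in P -> 0 <= x p) -> (#|Q| <= #|P|)%N -> wt Q <= wt P.
Proof.
move=> sep x0 /card_setD_le cQP.
rewrite (wt_setID P Q) (wt_setID Q P) setIC lerD2l.
have [->|[q0]] := set_0Vmem (Q :\: P).
  by rewrite [X in X <= _]big_set0 wt_ge0 // => u /setDP [/x0].
rewrite !inE => /andP [q0P q0Q].
have /card_gt0P [p0 p0P] : (0 < #|P :\: Q|)%N.
  by apply: leq_trans cQP; apply/card_gt0P; exists q0; rewrite !inE q0P.
pose p := [arg min_(i < p0 in P :\: Q) x i]%O.
have [pP pmin] : p \in P :\: Q /\ forall i, i \in P :\: Q -> x p <= x i.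
  by rewrite /p; case: arg_minP.
move: pP; rewrite !inE => /andP [pQ pP].
apply: (@le_trans _ _ (x p *+ #|Q :\: P|)).
  by apply: wt_bounds => u /setDP [uQ uP]; apply: sep.
apply: (@le_trans _ _ (x p *+ #|P :\: Q|)); last exact: wt_lbounds.
by rewrite ler_wpMn2l ?x0.
Qed.

(** If some [q] lay outside [P], it could be paired with some [p] in [P :\: Q]; the remaining sets
    still compare by [wt_le_sep], and the strict gap between [p] and [q] contradicts the assumed
    order of the weights. *)
Lemma wt_sep_sub P Q :
  (forall p q, p \in P -> p \notin Q -> q \in Q -> q \notin P -> x q < x p) ->
  (forall p, p \in P -> 0 <= x p) -> (#|Q| <= #|P|)%N -> wt P <= wt Q ->
  Q \subset P.
Proof.
move=> sep x0 cQP wPQ; rewrite -setD_eq0; apply/eqP.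
have [//|[q]] := set_0Vmem (Q :\: P); rewrite !inE => /andP [qP qQ].
have /card_gt0P [p pPQ] : (0 < #|P :\: Q|)%N.
  apply: leq_trans (card_setD_le cQP); apply/card_gt0P; exists q.
  by rewrite !inE qP.
move: pPQ; rewrite !inE => /andP [pQ pP].
suff : wt (Q :\ q) <= wt (P :\ p).
  move=> W; exfalso; move: wPQ; rewrite (wtD1 qQ) (wtD1 pP).
  by have := sep p q pP pQ qQ qP; lra.
apply: wt_le_sep => [a b|a /setD1P [_ /x0] //|]; last first.
  by move: cQP; rewrite (cardsD1 q Q) (cardsD1 p P) pP qQ.
rewrite !inE negb_and negbK => /andP [ap aP] aQ /andP [bq bQ] bP.
have bp : b != p by apply: contraNneq pQ => <-.
have aq : a != q by apply: contraNneq qP => <-.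
rewrite (negPf aq) in aQ; rewrite bp /= in bP.
by apply/ltW/sep.
Qed.

Lemma wt_sub_eq P Q : Q \subset P -> (forall p, p \in P -> 0 < x p) ->
  wt P <= wt Q -> P = Q.
Proof.
move=> QP x0; rewrite (wt_setID P Q) (setIidPr QP) gerDl => w0.
apply/eqP; rewrite eqEsubset QP andbT -setD_eq0 -cards_eq0 -leqn0 leqNgt.
apply/negP => /wt_gt0 W; move: w0; rewrite leNgt => /negP; apply; apply: W.
by move=> u /setDP [/x0].
Qed.

Lemma wt_sep_eq P Q :
  (forall p q, p \in P -> p \notin Q -> q \in Q -> q \notin P -> x q < x p) ->
  (forall p, p \in P -> 0 < x p) -> (#|Q| <= #|P|)%N -> wt P <= wt Q -> P = Q.
Proof.
move=> sep x0 cQP wPQ; apply: wt_sub_eq => //.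
by apply: wt_sep_sub => // p /x0 /ltW.
Qed.

(** Ties are allowed here, so [P = Q] cannot be concluded. The cardinalities agree nevertheless,
    because a surplus element of [P] would have positive weight. *)
Lemma wt_le_sep_card P Q :
  (forall p q, p \in P -> p \notin Q -> q \in Q -> q \notin P -> x q <= x p) ->
  (forall p, p \in P -> 0 < x p) -> (#|Q| <= #|P|)%N -> wt P <= wt Q ->
  #|Q| = #|P|.
Proof.
move=> sep x0 cQP wPQ; apply/eqP; rewrite eqn_leq cQP leqNgt; apply/negP => lQP.
have /card_gt0P [p] : (0 < #|P :\: Q|)%N.
  by move: lQP; rewrite -(cardsID Q P) -(cardsID P Q) setIC; lia.
rewrite !inE => /andP [pQ pP].
suff : wt Q <= wt (P :\ p).
  by move: wPQ; rewrite (wtD1 pP); have := x0 _ pP; lra.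
apply: wt_le_sep => [a b /setD1P [ap aP] aQ bQ|a /setD1P [_ /x0/ltW] //|].
  rewrite !inE negb_and negbK => /orP [/eqP bp|bP]; last exact: sep.
  by move: bQ; rewrite bp (negPf pQ).
by move: lQP; rewrite (cardsD1 p P) pP.
Qed.

Lemma wt_lt_sep P Q c :
  (forall p q, p \in P -> p \notin Q -> q \in Q -> q \notin P -> x q <= x p) ->
  (forall p, p \in P -> 0 < x p) -> (#|Q| <= #|P|)%N ->
  c \in P -> c \notin Q -> (forall q, q \in Q -> q \notin P -> x q < x c) ->
  wt Q < wt P.
Proof.
move=> sep x0 cQP cP cQ cq; rewrite ltNge; apply/negP => wPQ.
have cE := wt_le_sep_card sep x0 cQP wPQ.
have /card_gt0P [q] : (0 < #|Q :\: P|)%N.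
  have : (0 < #|P :\: Q|)%N by apply/card_gt0P; exists c; rewrite !inE cQ.
  by move: cE; rewrite -(cardsID P Q) -(cardsID Q P) setIC; lia.
rewrite !inE => /andP [qP qQ]; have qc := cq _ qQ qP.
suff : wt (Q :\ q) <= wt (P :\ c).
  by move=> W; move: wPQ; rewrite (wtD1 qQ) (wtD1 cP); lra.
apply: wt_le_sep => [a b|a /setD1P [_ /x0/ltW] //|]; last first.
  by move: cE; rewrite (cardsD1 q Q) (cardsD1 c P) cP qQ; lia.
rewrite !inE !negb_and !negbK.
move=> /andP [ac aP] /orP [/eqP aq|aQ] /andP [bq bQ] /orP [/eqP bc|bP].
- by rewrite -bc bQ in cQ.
- by rewrite -aq aP in qP.
- by rewrite -bc bQ in cQ.
- exact: sep.
Qed.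

(** Ranks are positions in a sorted list, so equal weights still get distinct ranks and every
    interval of ranks has exactly the expected size. Vertices outside [W] have rank at least [#|W|]
    and fall into no such interval. *)
Lemma decreasing_rank (W : {set V}) : exists pi : V -> nat,
  [/\ forall u, (u \in W) = (pi u < #|W|)%N,
      forall i j, (i <= j <= #|W|)%N ->
        #|[set u | (i <= pi u < j)%N]| = (j - i)%N &
      forall u v, u \in W -> v \in W -> (pi u < pi v)%N -> x v <= x u].
Proof.
pose ler := fun a b => x b <= x a.
pose s := sort ler (enum W).
have sW : size s = #|W| by rewrite size_sort cardE.
have su : uniq s by rewrite sort_uniq enum_uniq.
have sm u : (u \in s) = (u \in W) by rewrite mem_sort mem_enum.
have ss : sorted ler s by apply: sort_sorted => a b; apply: le_total.
have ltr : transitive ler by move=> a b c /= ba ac; apply: le_trans ac ba.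
exists (index^~ s); split=> [u|i j /andP [ij jW]|u v uW vW uv].
- by rewrite -sm -sW index_mem.
- have js : (j <= size s)%N by rewrite sW.
  have -> : [set u | (i <= index u s < j)%N] = [set u in drop i (take j s)].
    apply/setP => u; rewrite !inE.
    have [us|us] := boolP (u \in s); last first.
      rewrite (memNindex us) ltnNge js andbF; apply/esym/negbTE.
      by apply: contra us => /mem_drop /mem_take.
    have ut : (u \in take j s) = (index u s < j)%N by rewrite in_take.
    have [uj|uj] := ltnP (index u s) j; last first.
      rewrite andbF; apply/esym/negbTE; apply/negP => /mem_drop.
      by rewrite ut ltnNge uj.
    rewrite andbT; have uj' : u \in take j s by rewrite ut.
    have iu : index u (take j s) = index u s.
      by rewrite -{2}(cat_take_drop j s) index_cat uj'.
    have := cat_take_drop i (take j s); set t := take j s in uj' iu *.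
    move=> tE; have tu : uniq (take i t ++ drop i t) by rewrite tE take_uniq.
    move: tu; rewrite cat_uniq => /and3P [_ /hasPn tu _].
    rewrite -iu leqNgt -(in_take _ uj') .
    move: uj'; rewrite -{1}tE mem_cat => /orP [ut1|ut2].
      rewrite ut1; apply/esym/negbTE; apply/negP => ut2.
      by have := tu _ ut2; rewrite ut1.
    by rewrite ut2; apply: tu.
  rewrite cardsE (card_uniqP _) ?size_drop ?size_take_min ?(minn_idPl js) //.
  by rewrite drop_uniq // take_uniq.
have := sorted_ltn_nth ltr u ss; move=> /(_ (index u s) (index v s)).
rewrite !inE !index_mem !sm uW vW => /(_ isT isT uv).
by rewrite /ler !nth_index // sm.
Qed.

End Weights.

Local Close Scope ring_scope.

(** * Almost complete graphs *)

(** The classes of a given label are matched through their enumerations. Any such matching is an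
    isomorphism, since adjacency of distinct vertices depends on labels only. *)
Lemma isomorphic_by_labels (T : eqType) (M : rel T) (G H : sgraph)
    (lG : G -> T) (lH : H -> T) :
  (forall u v, adj u v = (u != v) && M (lG u) (lG v)) ->
  (forall u v, adj u v = (u != v) && M (lH u) (lH v)) ->
  (forall t, #|[set u | lG u == t]| = #|[set u | lH u == t]|) ->
  isomorphic G H.
Proof.
move=> adjG adjH cGH.
have [h0|H0] := pickP (fun _ : H => true); last first.
  have G0 (u : G) : False.
    have : 0 < #|[set w | lG w == lG u]| by apply/card_gt0P; exists u;
      rewrite inE.
    by rewrite cGH => /card_gt0P [w _]; have := H0 w.
  exists (fun u => match G0 u with end); split=> [|u]; last by case: (G0 u).
  have H' (w : H) : False by have := H0 w.
  by exists (fun w => match H' w with end) => u; [case: (G0 u) | case: (H' u)].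
pose cG t := enum [set w | lG w == t]; pose cH t := enum [set w | lH w == t].
have cs t : size (cG t) = size (cH t) by rewrite -!cardE.
have mG u : u \in cG (lG u) by rewrite mem_enum inE.
have mH u : u \in cH (lH u) by rewrite mem_enum inE.
move=> _; pose f u := nth h0 (cH (lG u)) (index u (cG (lG u))).
have fl u : lH (f u) = lG u.
  have : f u \in cH (lG u) by rewrite mem_nth // -cs index_mem.
  by rewrite mem_enum inE => /eqP.
have finj : injective f.
  move=> u v fuv; have luv : lG u = lG v by rewrite -!fl fuv.
  move: fuv; rewrite /f luv => /eqP.
  have mGu : u \in cG (lG v) by rewrite -luv.
  rewrite nth_uniq ?enum_uniq -?cs ?index_mem // => /eqP.
  exact: index_inj.
exists f; split; last by move=> u v; rewrite adjG adjH !fl (inj_eq finj).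
apply: inj_card_bij => //; rewrite -(card_codom finj).
apply/subset_leq_card/subsetP => w _; apply/codomP.
have wi : index w (cH (lH w)) < size (cG (lH w)) by rewrite cs index_mem.
have [u0 _] : exists u0, u0 \in cG (lH w).
  by case: (cG (lH w)) wi => // u0 s _; exists u0; rewrite mem_head.
pose u := nth u0 (cG (lH w)) (index w (cH (lH w))).
have uE : u \in cG (lH w) by rewrite mem_nth.
have ul : lG u = lH w by move: uE; rewrite mem_enum inE => /eqP.
by exists u; rewrite /f ul /u index_uniq ?enum_uniq ?nth_index.
Qed.

(* Labels of the vertices of the graphs [near_complete r A B N] below: [None] is
   the vertex r; in [Some (c, b)], the boolean b tells whether the vertex is
   a neighbour of r, and c whether it is in A ([Some true]), in B
   ([Some false]) or in neither of them ([None]). *)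
Definition label : Type := option (option bool * bool).

Definition label_adj (s t : label) : bool :=
  match s, t with
  | None, None => false
  | None, Some (_, b) | Some (_, b), None => b
  | Some (Some p, _), Some (Some q, _) => p == q
  | _, _ => true
  end.

(** The letters [f], [a], [b] stand for the core, A and B; the suffixes [i] and [o] for vertices
    inside and outside the neighbourhood of the special vertex. By [profile_isomorphic] the six
    numbers determine the graph. *)
Definition has_profile (H : sgraph) (fi fo ai ao bi bo : nat) : Prop :=
  exists l : H -> label,
    (forall u v, adj u v = (u != v) && label_adj (l u) (l v)) /\
    forall t, #|[set u | l u == t]| =
      match t with
      | None => 1
      | Some (c, b) =>
        match c with
        | None => if b then fi else fo
        | Some true => if b then ai else ao
        | Some false => if b then bi else bo
        end
      end.

Lemma profile_isomorphic (G H : sgraph) fi fo ai ao bi bo :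
  has_profile G fi fo ai ao bi bo -> has_profile H fi fo ai ao bi bo ->
  isomorphic G H.
Proof.
move=> [lG [aG cG]] [lH [aH cH]].
by apply: (isomorphic_by_labels aG aH) => t; rewrite cG cH.
Qed.

(* The vertices outside A, B and r form the core, which plays the role of the
   cut; the nonadjacent pairs are those in A x B, and r with the vertices that
   are not in N. *)
Section NearComplete.
Variables (V : finType) (r : V) (A B N : {set V}).

Definition near_complete_adj : rel V := fun u v =>
  [&& u != v, ~~ ((u \in A) && (v \in B)), ~~ ((u \in B) && (v \in A)),
      (u == r) ==> (v \in N) & (v == r) ==> (u \in N)].

Lemma near_complete_sym : symmetric near_complete_adj.
Proof.
move=> u v; rewrite /near_complete_adj eq_sym.
by do ![case: (_ \in _)]; do ![case: (_ == _)].
Qed.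

Lemma near_complete_irr : irreflexive near_complete_adj.
Proof. by move=> u; rewrite /near_complete_adj eqxx. Qed.

Definition near_complete : sgraph :=
  SGraph near_complete_sym near_complete_irr.

Definition near_complete_ok : bool :=
  [&& [disjoint A & B], r \notin A, r \notin B & r \notin N].

Definition core : {set V} := ~: (r |: A :|: B).

Hypothesis ok : near_complete_ok.

Lemma near_complete_profile :
  has_profile near_complete #|core :&: N| #|core :\: N| #|A :&: N| #|A :\: N|
    #|B :&: N| #|B :\: N|.
Proof.
have /and4P [/pred0P dAB rA rB rN] := ok.
exists (fun u => if u == r then None else
  Some (if u \in A then Some true else if u \in B then Some false else None,
        u \in N)); split=> [u v /=|t].
  rewrite /near_complete_adj; have [//|uv /=] := eqVneq u v.
  have := dAB u; have := dAB v => /=.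
  have [ur|ur] := eqVneq u r; have [vr|vr] := eqVneq v r => /=.
  - by move: uv; rewrite ur vr eqxx.
  - by rewrite ur (negPf rA) (negPf rB) /= andbT.
  - by rewrite vr (negPf rA) (negPf rB) !andbF /=; do ![case: (_ \in _)].
  - by do ![case: (_ \in _)].
transitivity #|[set u | match t with
  | None => u == r
  | Some (c, b) => [&& u != r, (u \in N) == b &
     match c with
     | None => (u \notin A) && (u \notin B)
     | Some true => u \in A
     | Some false => u \in B
     end]
  end]|.
  apply: eq_card => u; rewrite !inE; have [ur|ur] := eqVneq u r.
    by case: t => [[]|].
  case: t => [[c b]|] //=.
  rewrite (inj_eq Some_inj) xpair_eqE andbC; congr (_ && _).
  by have /= := dAB u; case: c => [[]|]; do ![case: (_ \in _)].
case: t => [[c b]|] /=; last first.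
  by rewrite -[RHS](cards1 r); apply: eq_card => u; rewrite !inE.
case: c => [[]|]; case: b; apply: eq_card => u; rewrite !inE;
  have [->|ur] := eqVneq u r; rewrite ?(negPf rA) ?(negPf rB) ?(negPf rN) //=;
  by do ![case: (_ \in _)].
Qed.

End NearComplete.

Local Open Scope ring_scope.

(** * Row sums and quadratic forms of almost complete graphs *)

Section NearCompleteSpectrum.
Variables (R : realType) (V : finType) (x : V -> R).
Variables (r : V) (A B N : {set V}).
Hypothesis ok : near_complete_ok r A B N.

(* The sum of [x u * x v] over the nonadjacent pairs: on a fixed vertex set,
   comparing quadratic forms at x amounts to comparing defects. *)
Definition defect : R :=
  wt x A * wt x B + x r * (wt x [set: V] - x r - wt x N).

(** From the complete graph, each family of nonadjacent pairs is subtracted. They do not overlap,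
    since [r] is in neither A nor B, so the coefficients of each [x v] can be compared case by
    case. *)
Lemma near_complete_adj_sum u :
  \sum_v (near_complete_adj r A B N u v)%:R * x v =
  wt x [set: V] - x u - (u \in A)%:R * wt x B - (u \in B)%:R * wt x A
   - (u == r)%:R * (wt x [set: V] - x r - wt x N)
   - ((u != r) && (u \notin N))%:R * x r.
Proof.
have /and4P [/pred0P dAB rA rB rN] := ok.
have wtE C : wt x C = \sum_v (v \in C)%:R * x v.
  by rewrite /wt big_mkcond; apply: eq_bigr => v _; case: (v \in C);
    rewrite ?mul1r ?mul0r.
have w1 w : x w = \sum_v (v == w)%:R * x v.
  rewrite (bigD1 w) //= eqxx mul1r big1 ?addr0 // => v /negPf ->.
  by rewrite mul0r.
rewrite [x u in RHS]w1 [x r in RHS]w1 !wtE -!sumrB !mulr_sumr -!sumrB.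
apply: eq_bigr => v _; rewrite /near_complete_adj in_setT (eq_sym u v).
have := dAB u; have := dAB v => /=.
have [vu|vu] := eqVneq v u.
  rewrite vu; have [->|ur] := eqVneq u r.
    by rewrite (negPf rA) (negPf rB) (negPf rN) /= => _ _; ring.
  by do ![case: (_ \in _)] => //= _ _; ring.
have [ur|ur] := eqVneq u r; have [vr|vr] := eqVneq v r.
- by move: vu; rewrite ur vr eqxx.
- by rewrite ur (negPf rA) (negPf rB) /=; do ![case: (_ \in _)] => //= _ _;
  ring.
- by rewrite vr (negPf rA) (negPf rB) /=; do ![case: (_ \in _)] => //= _ _;
  ring.
- by do ![case: (_ \in _)] => //= _ _; ring.
Qed.

Lemma near_complete_quad :
  @quad R (near_complete r A B N) x =
  wt x [set: V] ^+ 2 - \sum_u x u ^+ 2 - 2 * defect.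
Proof.
have /and4P [dAB rA rB rN] := ok.
have sE (C : {set V}) c : \sum_u x u * ((u \in C)%:R * c) = wt x C * c.
  rewrite /wt big_distrl [RHS]big_mkcond; apply: eq_bigr => v _ /=.
  by case: (v \in C); rewrite ?mul1r ?mul0r ?mulr0.
have -> : @quad R (near_complete r A B N) x =
  \sum_u x u * \sum_v (near_complete_adj r A B N u v)%:R * x v.
  apply: eq_bigr => u _; rewrite mulr_sumr; apply: eq_bigr => v _ /=; ring.
pose M := ~: (r |: N).
have ME : wt x M = wt x [set: V] - x r - wt x N.
  have := wt_setID x [set: V] M; rewrite setTI setTD setCK wtU1 //; lra.
have -> : \sum_u x u * \sum_v (near_complete_adj r A B N u v)%:R * x v =
  \sum_u (x u * ((u \in [set: V])%:R * wt x [set: V]) - x u ^+ 2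
   - x u * ((u \in A)%:R * wt x B) - x u * ((u \in B)%:R * wt x A)
   - x u * ((u \in [set r])%:R * wt x M) - x u * ((u \in M)%:R * x r)).
  apply: eq_bigr => u _; rewrite near_complete_adj_sum !inE negb_or -ME.
  by rewrite /=; move: (wt x M) (wt x A) (wt x B) (wt x [set: V]) => *; ring.
have r1 : wt x [set r] = x r by apply: big_set1.
rewrite !sumrB !sE r1 ME /defect.
by move: (wt x A) (wt x B) (wt x N) (wt x [set: V]) (\sum_u _) => *; ring.
Qed.

End NearCompleteSpectrum.

Lemma near_complete_profileC (V : finType) (r : V) (A B N : {set V})
    fi fo ai ao bi bo :
  has_profile (near_complete r A B N) fi fo ai ao bi bo ->
  has_profile (near_complete r B A N) fi fo ai ao bi bo.
Proof.
move=> [l [lE lc]]; exists l; split=> // u v; rewrite -lE /= /near_complete_adj.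
by case: (u != v) => //=; rewrite andbCA.
Qed.

Lemma near_complete_okC (V : finType) (r : V) (A B N : {set V}) :
  near_complete_ok r A B N = near_complete_ok r B A N.
Proof. by rewrite /near_complete_ok disjoint_sym; do ![case: (_ \notin _)]. Qed.

Lemma coreC (V : finType) (r : V) (A B : {set V}) : core r A B = core r B A.
Proof. by rewrite /core setUAC. Qed.

(** * Comparison through the Perron vector of a subgraph *)

Section Comparison.
Variables (R : realType) (G : sgraph) (x : G -> R).
Variables (r r' : G) (A B N A' B' N' : {set G}).
Hypotheses (ok : near_complete_ok r A B N) (ok' : near_complete_ok r' A' B' N').
Hypothesis xG : eigenvec (spectral_radius R G) x.
Hypotheses (x_ge0 : forall u, 0 <= x u) (x_neq0 : exists u, x u != 0).
Hypothesis subG : forall u v : G, adj u v -> near_complete_adj r A B N u v.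
Hypothesis le_defect : defect x r' A' B' N' <= defect x r A B N.

Let G0 : (0 < #|G|)%N. Proof. by apply/card_gt0P; exists r. Qed.

Let term_le u v : (adj u v)%:R * (x u * x v) <=
  (near_complete_adj r A B N u v)%:R * (x u * x v).
Proof.
apply: ler_wpM2r; first by rewrite mulr_ge0.
by rewrite ler_nat; have := @subG u v; case: (adj u v) => // ->.
Qed.

Let quad_le : quad x <= @quad R (near_complete r A B N) x.
Proof. by apply: ler_sum => u _; apply: ler_sum => v _; apply: term_le. Qed.

Let quad_le' : quad x <= @quad R (near_complete r' A' B' N') x.
Proof.
apply: (le_trans quad_le); rewrite !near_complete_quad //.
by rewrite lerD2l lerN2 ler_pM2l.
Qed.

Lemma defect_spectral_radius :
  spectral_radius R G <= spectral_radius R (near_complete r' A' B' N').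
Proof.
have := le_trans quad_le' (@rayleigh R (near_complete r' A' B' N') x G0).
rewrite (eigenvec_quad xG) ler_pM2r //.
have [u xu] := x_neq0; rewrite (bigD1 u) //=.
by rewrite ltr_pwDl ?sumr_ge0 // => [|v _]; rewrite ?exprn_even_gt0 ?sqr_ge0.
Qed.

(** Equality collapses the chain from the form of [G] to the form of the first almost complete
    graph, to that of the second, to the Rayleigh bound. The last link gives the eigenvector. The
    first one gives [G] itself, but only for positive [x]: an added edge [u v] contributes
    [x u * x v]. *)
Lemma defect_spectral_radius_eq :
  spectral_radius R G = spectral_radius R (near_complete r' A' B' N') ->
  [/\ @eigenvec R (near_complete r' A' B' N')
        (spectral_radius R (near_complete r' A' B' N')) x,
      defect x r' A' B' N' = defect x r A B N &
      (forall u, 0 < x u) ->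
      forall u v : G, adj u v = near_complete_adj r A B N u v].
Proof.
move=> rhoE.
have qE : quad x = @quad R (near_complete r' A' B' N') x.
  apply/le_anti; rewrite quad_le' /= (eigenvec_quad xG) rhoE.
  exact: (@rayleigh R (near_complete r' A' B' N') x G0).
split.
- by apply: rayleigh_eq => //; rewrite -rhoE -(eigenvec_quad xG) qE.
- have := quad_le; rewrite qE !near_complete_quad // lerD2l lerN2 ler_pM2l //.
  by move=> ?; apply/le_anti/andP.
move=> x_gt0.
have : quad x = @quad R (near_complete r A B N) x.
  apply/le_anti; rewrite quad_le qE !near_complete_quad //.
  by rewrite lerD2l lerN2 ler_pM2l.
move=> /esym /eqP;
  rewrite -subr_eq0 /quad -sumrB psumr_eq0 => [/allP H u v|u _].
  have := H u (mem_index_enum u); rewrite /= -sumrB psumr_eq0 => [/allP|w _].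
    move=> /(_ v (mem_index_enum v)) /=; rewrite -mulrBl mulf_eq0 subr_eq0.
    rewrite [x u * _ == 0]gt_eqF ?mulr_gt0 // orbF eqr_nat.
    have eq_bool (p q : bool) : (p == q :> nat) -> q = p by case: p; case: q.
    exact: eq_bool.
  by rewrite subr_ge0 term_le.
by rewrite -sumrB; apply: sumr_ge0 => w _; rewrite subr_ge0 term_le.
Qed.

(** The last hypothesis is the equality analysis, which each configuration has to supply: there the
    almost complete graph containing [G] is [G] itself, so its profile is that of [G]. *)
Lemma defect_rho_extremal (H : sgraph) fi fo ai ao bi bo :
  (forall u, 0 < x u) ->
  has_profile H fi fo ai ao bi bo ->
  has_profile (near_complete r' A' B' N') fi fo ai ao bi bo ->
  (@eigenvec R (near_complete r' A' B' N')
     (spectral_radius R (near_complete r' A' B' N')) x ->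
   defect x r' A' B' N' = defect x r A B N ->
   has_profile (near_complete r A B N) fi fo ai ao bi bo) ->
  rho_extremal R G H.
Proof.
move=> x_gt0 pH p' pE.
have HE := isomorphic_spectral_radius R (profile_isomorphic p' pH).
split; first by rewrite -HE; apply: defect_spectral_radius.
split; last exact: isomorphic_spectral_radius.
rewrite -HE => /defect_spectral_radius_eq [xE dE adjE].
have [l [lE lc]] := pE xE dE.
apply: profile_isomorphic pH; exists l; split=> // u v.
by rewrite -lE adjE.
Qed.

End Comparison.

Lemma rho_extremal_lt (R : realType) (G H : sgraph) :
  spectral_radius R G < spectral_radius R H -> rho_extremal R G H.
Proof.
move=> lt; split; first exact: ltW.
by split=> [rE|/(isomorphic_spectral_radius R) rE]; move: lt; rewrite rE ltxx.
Qed.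

Section EigenEquation.
Variables (R : realType) (V : finType) (x : V -> R).
Variables (r : V) (A B N : {set V}).
Hypothesis ok : near_complete_ok r A B N.

(** With [x u] added to both sides, the right-hand side depends only on the class of [u], so weights
    of different classes are compared through the weights that they miss. *)
Lemma near_complete_eigen rho :
  @eigenvec R (near_complete r A B N) rho x ->
  forall u, (rho + 1) * x u = wt x [set: V]
   - (u \in A)%:R * wt x B - (u \in B)%:R * wt x A
   - (u == r)%:R * (wt x [set: V] - x r - wt x N)
   - ((u != r) && (u \notin N))%:R * x r.
Proof.
move=> xE u; have := xE u; rewrite /= near_complete_adj_sum // mulrDl mul1r.
by move=> <-; ring.
Qed.

Lemma wt_core : wt x [set: V] = x r + wt x (core r A B) + wt x A + wt x B.
Proof.
have /and4P [dAB rA rB rN] := ok.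
have := wt_setID x [set: V] (core r A B); rewrite setTI setTD setCK -setUA.
rewrite wtU1 ?inE ?negb_or ?rA ?rB // wtU // => ->; ring.
Qed.

End EigenEquation.

Section Parts.
Variables (V : finType) (r : V) (A B N : {set V}).
Hypothesis ok : near_complete_ok r A B N.

Lemma card_parts : #|V| = (1 + #|core r A B| + #|A| + #|B|)%N.
Proof.
have /and4P [dAB rA rB rN] := ok.
rewrite -(cardsC (core r A B)) setCK -setUA cardsU1 !inE negb_or rA rB /=.
rewrite cardsU; move: dAB; rewrite -setI_eq0 => /eqP ->.
by rewrite cards0 subn0 addnCA -!addnA.
Qed.

(** The operator is generic so that counting and weighing the neighbourhood are both instances. *)
Lemma big_parts (T : Type) (idx : T) (op : Monoid.com_law idx) (F : V -> T) :
  \big[op/idx]_(u in N) F u =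
  op (op (\big[op/idx]_(u in core r A B :&: N) F u)
         (\big[op/idx]_(u in A :&: N) F u))
     (\big[op/idx]_(u in B :&: N) F u).
Proof.
have /and4P [dAB rA rB rN] := ok.
rewrite (big_setID (A :|: B)) /= Monoid.mulmC -Monoid.mulmA; congr (op _ _).
  apply: eq_bigl => u; rewrite !inE !negb_or.
  have [->|] := eqVneq u r; first by rewrite (negPf rN) andbF.
  by move=> _; rewrite -negb_or.
rewrite (big_setID A) /=; congr (op _ _); apply: eq_bigl => u; rewrite !inE.
  by do ![case: (_ \in _)].
have := pred0P dAB u => /=; by do ![case: (_ \in _)].
Qed.

Lemma card_nbr_parts :
  #|N| = (#|core r A B :&: N| + #|A :&: N| + #|B :&: N|)%N.
Proof. by rewrite -!sum1_card (big_parts addn). Qed.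

Lemma wt_nbr_parts (R : realFieldType) (x : V -> R) :
  wt x N = wt x (core r A B :&: N) + wt x (A :&: N) + wt x (B :&: N).
Proof. exact: big_parts. Qed.

(** This is the shape of [graph_deltag_g]: the special vertex sees all of the small part, nothing of
    the large one, and has its other neighbours in the core. *)
Lemma near_complete_profile_sub : B \subset N -> [disjoint A & N] ->
  has_profile (near_complete r A B N) (#|N| - #|B|)
    (#|core r A B| - (#|N| - #|B|)) 0 #|A| #|B| 0.
Proof.
move=> BN; rewrite -setI_eq0 => /eqP dAN.
have BNE : B :&: N = B by apply/setIidPl.
have c0 : #|core r A B :&: N| = (#|N| - #|B|)%N.
  by rewrite card_nbr_parts dAN cards0 addn0 BNE addnK.
have := near_complete_profile ok.
rewrite !cardsD c0 dAN BNE cards0 subn0 subnn //.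
Qed.

(** A core vertex is adjacent to all vertices except possibly [r], and [r] has a neighbour. *)
Lemma near_complete_connected f :
  f \in core r A B -> (0 < #|N|)%N -> connected (near_complete r A B N).
Proof.
move=> fC /card_gt0P [w wN]; have /and4P [dAB rA rB rN] := ok.
have hub u : u != r -> connect (near_complete_adj r A B N) f u.
  move=> ur; have [->|uf] := eqVneq u f; first exact: connect0.
  apply: connect1; move: fC; rewrite /near_complete_adj eq_sym uf !inE !negb_or.
  by move=> /andP [/andP [/negPf -> /negPf ->] /negPf ->]; rewrite (negPf ur).
have wr : w != r by apply: contraNneq rN => <-.
have sym := sym_connect_sym (near_complete_sym r A B N).
have all_hub u : connect (near_complete_adj r A B N) f u.
  have [->|] := eqVneq u r; last exact: hub.
  apply: connect_trans (hub _ wr) _; apply: connect1.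
  have dw := pred0P dAB w; rewrite /near_complete_adj wr (negPf rA) (negPf rB).
  by rewrite !andbF (negPf wr) wN eqxx.
by move=> u v; apply: (@connect_trans _ _ f); rewrite ?all_hub // sym all_hub.
Qed.

End Parts.

(** * Rearrangements *)

(** Here [s1], [s2] are the weights of the old sides and [a], [b] those of the new ones. For
    [0 <= b <= s1, s2] and [a + b <= s1 + s2] both summands are nonnegative. *)
Lemma defect_product (R : comPzRingType) (s1 s2 a b : R) :
  s1 * s2 - a * b = (s1 - b) * (s2 - b) + b * (s1 + s2 - a - b).
Proof. ring. Qed.

(** * The special vertex lies in the cut *)

Section JoinedVertex.
Variables (R : realType) (V : finType) (x : V -> R).
Hypothesis x_gt0 : forall u, 0 < x u.

(* The new core and N' are initial segments of the vertices other than r, sorted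
   by decreasing weight; B is a final segment. *)
Lemma joined_vertex_bound (r : V) (C1 C2 N : {set V}) (m : nat) :
  near_complete_ok r C1 C2 N -> (0 < m)%N -> (m <= #|C1|)%N -> (m <= #|C2|)%N ->
  (#|N| + m < #|V|)%N \/ #|N| = (#|V| - 1)%N ->
  exists A B N' : {set V},
  [/\ near_complete_ok r A B N',
      [/\ #|B| = m, #|N'| = #|N|, #|core r A B| = #|core r C1 C2|,
        core r A B \subset N' \/ N' \subset core r A B &
        ((#|N| + m < #|V|)%N -> [disjoint B & N'])],
      defect x r A B N' <= defect x r C1 C2 N &
      forall rho, 0 <= rho -> @eigenvec R (near_complete r A B N') rho x ->
        defect x r A B N' = defect x r C1 C2 N ->
        has_profile (near_complete r C1 C2 N)
          #|core r A B :&: N'| #|core r A B :\: N'|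
          #|A :&: N'| #|A :\: N'| #|B :&: N'| #|B :\: N'|].
Proof.
move=> ok m0 mC1 mC2.
have [d dE] : exists d, d = #|N| by eexists.
have [k kE'] : exists k, k = #|core r C1 C2| by eexists.
have [n1 n1E] : exists n1, n1.+1 = #|V|.
  by exists #|V|.-1; rewrite prednK //; apply/card_gt0P; exists r.
have -> : (#|N| + m < #|V|)%N = (d + m <= n1)%N by rewrite -n1E dE.
have -> : (#|V| - 1)%N = n1 by rewrite -n1E subn1.
rewrite -kE' -dE => dm.
have /and4P [dC rC1 rC2 rN] := ok.
have kE : (k + #|C1| + #|C2|)%N = n1.
  have := cardsC (r |: (C1 :|: C2)); rewrite cardsU1 !inE negb_or rC1 rC2 /=.
  rewrite cardsU; move: (dC); rewrite -setI_eq0 => /eqP ->; rewrite cards0.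
  rewrite setUA -/(core r C1 C2) -kE' -[RHS]n1E.
  by move: #|C1| #|C2| => c1 c2; clear; lia.
have cW : #|~: [set r]| = n1 by rewrite cardsC1 -n1E.
have [pi [piW pic pix]] := decreasing_rank x (~: [set r]).
rewrite cW in piW pic.
have piW' u : (u != r) = (pi u < n1)%N by rewrite -piW !inE.
have dn1 : (d <= n1)%N.
  rewrite -cW dE; apply: subset_leq_card; apply/subsetP => u uN; rewrite !inE.
  by apply: contraNneq rN => <-.
have pr : (n1 <= pi r)%N by rewrite leqNgt -piW' eqxx.
have sorted_pi u v : u != r -> v != r -> (pi u < pi v)%N -> x v <= x u.
  by move=> ur vr; apply: pix; rewrite !inE.
(* The ranks below [k] form the core, those from [k] to [e] form [A], and the last [m] ranks form
   [B]. Being initial segments, the core and [N'] are nested; [r] has rank at least [n1] and is in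
   none of the segments. *)
have [e eE] : exists e, (e + m)%N = n1.
  by exists (n1 - m)%N; rewrite subnK // -kE (leq_trans mC2) // leq_addl.
pose A := [set u | (k <= pi u < e)%N].
pose B := [set u | (e <= pi u < n1)%N].
pose N' := [set u | (0 <= pi u < d)%N].
have ke : (k <= e)%N
  by rewrite -(leq_add2r m) eE -kE -addnA leq_add2l (leq_trans mC1) ?leq_addr.
have en : (e <= n1)%N by rewrite -eE leq_addr.
have kn := leq_trans ke en.
have dB : [disjoint A & B].
  by rewrite -setI_eq0; apply/eqP/setP => u; rewrite !inE; apply/negbTE; clear;
    lia.
have ok' : near_complete_ok r A B N'.
  by rewrite /near_complete_ok dB !inE; clear -pr en dn1; apply/and4P;
    split=> //; lia.
have coreE : core r A B = [set u | (0 <= pi u < k)%N].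
  apply/setP => u; rewrite !inE !negb_or piW'; clear -ke en; lia.
have ck : #|core r A B| = k by rewrite coreE pic ?subn0 // kn.
have cA : #|A| = (e - k)%N by rewrite pic // ke.
have cB : #|B| = m by rewrite pic ?en ?leqnn // -eE addKn.
have cN : #|N'| = d by rewrite pic ?subn0 // dn1.
have x0 (P : {set V}) : forall u : V, u \in P -> 0 <= x u by move=> u _;
  apply: ltW.
have x0' (P : {set V}) : forall u : V, u \in P -> 0 < x u by [].
have neq_r (P : {set V}) u : r \notin P -> u \in P -> u != r.
  by move=> rP uP; apply: contraNneq rP => <-.
have wN : wt x N <= wt x N'.
  apply: (wt_le_sep _ (x0 _)) => [p q|]; last by rewrite cN dE.
  rewrite !inE => pN _ qN qN'; have qr := neq_r _ _ rN qN.
  apply: sorted_pi => //; first by rewrite piW'; clear -pN dn1; lia.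
  by clear -pN qN'; lia.
have sepB (C : {set V}) : r \notin C ->
    forall p q, p \in C -> p \notin B -> q \in B -> q \notin C -> x q <= x p.
  move=> rC p q pC; rewrite !inE => pB qB _.
  have pr' := neq_r _ _ rC pC; have := pr'; rewrite piW' => pn.
  apply: sorted_pi => //; first by rewrite piW'; clear -qB; lia.
  by clear -pB qB pn; lia.
have wC1 : wt x B <= wt x C1.
  by apply: (wt_le_sep _ (x0 _)); [exact: sepB | rewrite cB].
have wC2 : wt x B <= wt x C2.
  by apply: (wt_le_sep _ (x0 _)); [exact: sepB | rewrite cB].
have wS := wt_core x ok; have wS' := wt_core x ok'.
have wF : wt x (core r C1 C2) <= wt x (core r A B).
  apply: (wt_le_sep _ (x0 _)) => [p q|]; last by rewrite ck kE'.
  rewrite coreE => pk _ qC qk; rewrite !inE in pk qk; have qr : q != r.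
    by move: qC; rewrite !inE !negb_or => /andP [/andP []].
  apply: sorted_pi => //; first by rewrite piW'; clear -pk kn; lia.
  by clear -pk qk; lia.
have B0 : 0 < wt x B by apply: wt_gt0; rewrite ?cB.
have le_def : defect x r A B N' <= defect x r C1 C2 N.
  rewrite /defect lerD //; last by rewrite ler_pM2l // lerD2l lerN2.
  rewrite -subr_ge0 defect_product addr_ge0 ?mulr_ge0 ?subr_ge0 //.
  - exact: ltW.
  - by move: wS wS' wF; clear; lra.
exists A, B, N'; split=> //.
  split=> //.
    by rewrite coreE; have [kd|/ltnW kd] := leqP d k; [right|left];
      apply/subsetP => u; rewrite !inE => ud; clear -kd ud; lia.
  move=> dm'; rewrite -setI_eq0; apply/eqP/setP => u; rewrite !inE.
  by apply/negbTE; clear -dm' eE; lia.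
move=> rho rho0 /(near_complete_eigen ok') xE defE.
have rho1 : 0 < rho + 1 by rewrite ltr_wpDl.
have cmp u v : (rho + 1) * x u < (rho + 1) * x v -> x u < x v
  by rewrite ltr_pM2l.
have wBA : wt x B <= wt x A.
  apply: (wt_le_sep _ (x0 _)); last by rewrite cA cB; clear -mC1 mC2 kE eE; lia.
  by apply: sepB; have /and4P [] := ok'.
have e1 : x r * (wt x [set: V] - x r - wt x N') <= x r * (wt x [set: V] - x r -
  wt x N).
  by rewrite ler_pM2l // lerD2l lerN2.
have e2 : 0 <= (wt x C1 - wt x B) * (wt x C2 - wt x B).
  by rewrite mulr_ge0 // subr_ge0.
have e3 : 0 <= wt x B * (wt x C1 + wt x C2 - wt x A - wt x B).
  by rewrite mulr_ge0 ?(ltW B0) //; move: wS wS' wF; clear; lra.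
have e4 := defect_product (wt x C1) (wt x C2) (wt x A) (wt x B).
(* The difference of the defects is a sum of three nonnegative gaps, so equality makes each of them
   vanish. *)
have [f1 f2 f3] : [/\ wt x N' = wt x N,
   (wt x C1 - wt x B) * (wt x C2 - wt x B) = 0
   & wt x B * (wt x C1 + wt x C2 - wt x A - wt x B) = 0].
  move: defE; rewrite /defect => defE.
  split; try by move: defE e1 e2 e3 e4; clear; lra.
  have : x r * (wt x [set: V] - x r - wt x N') = x r * (wt x [set: V] - x r - wt
    x N).
    by move: defE e1 e2 e3 e4; clear; lra.
  by move/(mulfI (lt0r_neq0 (x_gt0 r))); clear; lra.
have xr := x_gt0 r.
(* A vertex outside [N'] misses [r], which costs [x r > 0]. This is not offset elsewhere: a vertex
   of [N'] in the presence of an outside vertex is not in [B], so it misses at most [wt x B], which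
   is no more than what a vertex of [A] or [B] misses. *)
have sepN u v : u \in N' -> v \notin N' -> v != r -> x v < x u.
  rewrite !inE => ud vd vr; have := vr; rewrite piW' => vn.
  have ur : (u == r) = false.
    by apply/negbTE; rewrite piW'; clear -ud dn1; lia.
  have uB : (e <= pi u < n1)%N = false.
    by apply/negbTE; clear -ud vd vn dm eE; lia.
  apply: cmp; rewrite !xE !inE ur uB (negPf vr) ud (negbTE vd) /=.
  rewrite !mul0r !subr0 mul1r.
  case uA : (k <= pi u < e)%N => /=.
    have [vB|vB] := boolP (e <= pi v < n1)%N.
      have -> : (k <= pi v < e)%N = false by apply/negbTE; clear -vB; lia.
      by rewrite /= !mul1r mul0r; move: wBA B0 xr; clear; lra.
    have -> : (k <= pi v < e)%N by clear -uA ud vd vB vn; lia.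
    by rewrite /= !mul1r !mul0r; move: xr; clear; lra.
  have h1 : 0 <= (k <= pi v < e)%N%:R * wt x B by rewrite mulr_ge0 ?(ltW B0).
  have h2 : 0 <= (e <= pi v < n1)%N%:R * wt x A.
    by rewrite mulr_ge0 // (le_trans (ltW B0)).
  by move: h1 h2 xr; rewrite mul0r; clear; lra.
have NE : N' = N.
  apply: (@wt_sep_eq _ _ x) => //; [|by rewrite cN dE|by rewrite f1].
  by move=> p q pN' _ qN qN'; apply: sepN => //; apply: neq_r qN.
have A0 : 0 < wt x A by apply: lt_le_trans wBA.
have coreE' : core r A B = core r C1 C2.
  apply: (@wt_sep_eq _ _ x) => //; [|by rewrite ck kE'|]; last first.
    move/eqP: f3; rewrite mulf_eq0 gt_eqF //= => /eqP.
    by move: wS wS'; clear; lra.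
  move=> p q; rewrite coreE => pk _ qC qk; rewrite !inE in pk qk;
    have qr : q != r.
    by move: qC; rewrite !inE !negb_or => /andP [/andP []].
  have := qr; rewrite piW' => qn.
  apply: cmp; rewrite !xE !inE.
  have -> : (p == r) = false by apply/negbTE; rewrite piW'; clear -pk kn; lia.
  have -> : (k <= pi p < e)%N = false by apply/negbTE; clear -pk; lia.
  have -> : (e <= pi p < n1)%N = false by apply/negbTE; clear -pk ke; lia.
  rewrite (negPf qr) /= !mul0r !subr0.
  have h0 : (~~ (pi p < d)%N)%:R * x r <= (~~ (pi q < d)%N)%:R * x r.
    rewrite ler_pM2r // ler_nat; case: (ltnP (pi p)) => // pd.
    by have -> : (pi q < d)%N = false by apply/negbTE; clear -pk qk pd; lia.
  have [qB|qB] := boolP (e <= pi q < n1)%N.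
    have -> : (k <= pi q < e)%N = false by apply/negbTE; clear -qB; lia.
    by rewrite /= !mul1r !mul0r; move: h0 A0; clear; lra.
  have -> : (k <= pi q < e)%N by clear -qB qk qn; lia.
  by rewrite /= !mul1r !mul0r; move: h0 B0; clear; lra.
have UE : A :|: B = C1 :|: C2.
  apply/setP => u; have := congr1 (fun S : {set V} => u \in S) coreE'.
  rewrite /core -!setUA !in_setC !(in_setU1 u r).
  have [->|ur /=] := eqVneq u r; last by move/negb_inj.
  by move=> _; rewrite !in_setU (negPf rC1) (negPf rC2) !inE; apply/negbTE;
    clear -pr en; lia.
(* For [wt x A = wt x B] the vertices of [A :\: N'] and of [B :\: N'] have the same weight, so
   [D2 = B] cannot be expected; only the counts are compared. A vertex of [N'] in [D2] would make
   [D2] strictly heavier than [B] when [B] avoids [N']. *)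
have prof (D1 D2 : {set V}) : near_complete_ok r D1 D2 N ->
  core r D1 D2 = core r A B ->
    D1 :|: D2 = A :|: B -> (m <= #|D2|)%N -> wt x D2 = wt x B ->
    has_profile (near_complete r D1 D2 N)
          #|core r A B :&: N'| #|core r A B :\: N'|
          #|A :&: N'| #|A :\: N'| #|B :&: N'| #|B :\: N'|.
  move=> okD cD DE mD wD; have /and4P [dD rD1 rD2 _] := okD.
  have c2 : #|D2| = m.
    by rewrite -cB; apply/esym; apply: (@wt_le_sep_card _ _ x) => //;
      rewrite ?cB ?wD //; apply: sepB.
  have i2 : #|D2 :&: N'| = #|B :&: N'|.
    have [dm'|dn] := dm; last first.
      have NV : N' = ~: [set r] by apply/setP => u; rewrite !inE piW' dn.
      rewrite NV -!setDE !(setDidPl _) ?c2 ?cB // disjoint_sym disjoints1 //.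
      by have /and4P [] := ok'.
    have BN : B :&: N' = set0.
      by apply/setP => u; rewrite !inE; apply/negbTE; clear -dm' eE; lia.
    rewrite BN; congr #|pred_of_set _|; apply/setP => c; rewrite in_set0.
    apply/negbTE/negP => /setIP [cD2 cN'].
    have : wt x B < wt x D2; last by rewrite wD ltxx.
    have BN' q : q \in B -> q \notin N'.
      by move=> qB; apply/negP => qN; move/setP/(_ q): BN;
        rewrite in_setI qB qN inE.
    apply: (@wt_lt_sep _ _ x _ _ c) => //; rewrite ?c2 ?cB //;
      first exact: sepB.
      by apply/negP => /BN'; rewrite cN'.
    move=> q qB _; apply: sepN => //; first exact: BN'.
    by apply: neq_r qB; have /and4P [] := ok'.
  have d2 : #|D2 :\: N'| = #|B :\: N'|.
    by apply/eqP; rewrite -(eqn_add2l #|B :&: N'|) -{1}i2 !cardsID c2 cB.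
  have dAB (S : {set V}) : (#|A :&: S| + #|B :&: S|)%N = (#|D1 :&: S| + #|D2 :&:
    S|)%N.
    rewrite -cardsUI -[RHS]cardsUI -!setIUl DE; congr (_ + _)%N.
    move: dB dD; rewrite -!setI_eq0 => /eqP dB /eqP dD.
    by rewrite !(setIC _ S) -!setIIr dB dD.
  have i1 : #|D1 :&: N'| = #|A :&: N'| by have /eqP := dAB N';
    rewrite i2 eqn_add2r => /eqP.
  have d1 : #|D1 :\: N'| = #|A :\: N'|.
    by have /eqP := dAB (~: N'); rewrite -!setDE d2 eqn_add2r => /eqP.
  have := near_complete_profile okD; rewrite -NE i1 i2 d1 d2 cD.
  by [].
(* One of the two sides weighs as much as [B]; whichever it is takes the part of [D2]. *)
move: f2 => /eqP; rewrite mulf_eq0 !subr_eq0 => /orP [] /eqP wE.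
  apply: near_complete_profileC; apply: prof => //.
  - by rewrite -near_complete_okC.
  - by rewrite coreC.
  - by rewrite UE setUC.
by apply: prof.
Qed.
End JoinedVertex.

Lemma subset_of_card (V : finType) (S : {set V}) n : (n <= #|S|)%N ->
  exists2 T : {set V}, T \subset S & #|T| = n.
Proof.
move=> nS; have /card_gt0P [T] : (0 < #|[set T : {set V} | (T \subset S) &&
  (#|T| == n)]|)%N.
  by rewrite cards_draws bin_gt0.
by rewrite inE => /andP [TS /eqP]; exists T.
Qed.

(** * The special vertex lies outside the cut *)

Section OutsideVertex.
Variables (R : realType) (V : finType) (x : V -> R).
Hypothesis x_gt0 : forall u, 0 < x u.

(** Sorting gives a core of the [k] heaviest vertices, a final segment [B] of size [g], and [N']
    made of the [t] heaviest vertices and [B]. The three bounds are all that is used of the order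
    afterwards, so the same construction serves for either choice of the special vertex. *)
Lemma sorted_near_complete (r : V) (k g t : nat) :
  (k + g < #|V|)%N -> (t <= k)%N ->
  exists A B N' : {set V},
  [/\ near_complete_ok r A B N',
      has_profile (near_complete r A B N') t (k - t) 0 (#|V| - 1 - k - g) g 0,
      forall C : {set V}, r \notin C -> (g <= #|C|)%N -> wt x B <= wt x C,
      forall C : {set V}, r \notin C -> (#|C| <= k)%N ->
        wt x C <= wt x (core r A B) &
      forall C : {set V}, r \notin C -> (#|C| <= t)%N ->
        wt x C + wt x B <= wt x N'].
Proof.
have [n1 n1E] : exists n1, n1.+1 = #|V|.
  by exists #|V|.-1; rewrite prednK //; apply/card_gt0P; exists r.
rewrite -n1E ltnS subn1 /= => kg tk.
have cW : #|~: [set r]| = n1 by rewrite cardsC1 -n1E.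
have [pi [piW pic pix]] := decreasing_rank x (~: [set r]).
rewrite cW in piW pic.
have piW' u : (u != r) = (pi u < n1)%N by rewrite -piW !inE.
have pr : (n1 <= pi r)%N by rewrite leqNgt -piW' eqxx.
have [e eE] : exists e, (e + g)%N = n1.
  by exists (n1 - g)%N; rewrite subnK // (leq_trans _ kg) // leq_addl.
have ke : (k <= e)%N by rewrite -(leq_add2r g) eE.
have en : (e <= n1)%N by rewrite -eE leq_addr.
pose A := [set u | (k <= pi u < e)%N].
pose B := [set u | (e <= pi u < n1)%N].
pose T := [set u | (0 <= pi u < t)%N].
pose N' := T :|: B.
have ok : near_complete_ok r A B N'.
  have dB : [disjoint A & B].
    by rewrite -setI_eq0; apply/eqP/setP => u; rewrite !inE; apply/negbTE;
      clear; lia.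
  by rewrite /near_complete_ok dB !inE; clear -pr ke en tk; apply/and4P;
    split=> //; lia.
have coreE : core r A B = [set u | (0 <= pi u < k)%N].
  by apply/setP => u; rewrite !inE !negb_or piW'; clear -ke en; lia.
have ck : #|core r A B| = k by rewrite coreE pic ?subn0 // (leq_trans ke).
have cA : #|A| = (e - k)%N by rewrite pic // ke.
have cB : #|B| = g by rewrite pic ?en ?leqnn // -eE addKn.
have cT : #|T| = t by rewrite pic ?subn0 //= (leq_trans tk) // (leq_trans ke).
have dTB : [disjoint T & B].
  rewrite -setI_eq0; apply/eqP/setP => u; rewrite !inE; apply/negbTE.
  by clear -tk ke; lia.
have cN : #|N'| = (t + g)%N.
  move: dTB; rewrite /N' cardsU -setI_eq0 => /eqP ->.
  by rewrite cards0 subn0 cT cB.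
have x0 (P : {set V}) : forall u : V, u \in P -> 0 <= x u.
  by move=> u _; apply: ltW.
have top (C : {set V}) i : r \notin C -> (i <= n1)%N -> (#|C| <= i)%N ->
    wt x C <= wt x [set u | (0 <= pi u < i)%N].
  move=> rC i_n Ci; apply: (wt_le_sep _ (x0 _)) => [p q|];
    last by rewrite pic ?subn0.
  rewrite !inE => pi' _ qC qi; have qr : q != r by apply: contraNneq rC => <-.
  by apply: pix; rewrite ?inE //; [rewrite piW'; clear -pi' i_n|clear -pi' qi];
    lia.
exists A, B, N'; split=> //.
- have := near_complete_profile_sub ok.
  rewrite cN cB addnK ck cA.
  have -> : (n1 - k - g = e - k)%N by rewrite subnAC -eE addnK.
  apply; first exact: subsetUr.
  rewrite -setI_eq0; apply/eqP/setP => u; rewrite !inE; apply/negbTE.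
  by clear -tk ke; lia.
- move=> C rC gC; apply: (wt_le_sep _ (x0 _)) => [p q|]; last by rewrite cB.
  rewrite !inE => pC pB qB _; have pr' : p != r by apply: contraNneq rC => <-.
  have := pr'; rewrite piW' => pn.
  by apply: pix; rewrite ?inE //; [rewrite piW'; clear -qB|clear -pn pB qB];
    lia.
- by move=> C rC Ck; rewrite coreE; apply: top => //; apply: leq_trans en.
- move=> C rC Ct; rewrite /N' wtU // lerD2r; apply: top => //.
  by rewrite (leq_trans tk) // (leq_trans ke).
Qed.

(* For any z in C, the new special vertex is the lighter one of v and z. *)
Lemma outside_vertex_bound (v : V) (C D N : {set V}) (g : nat) :
  near_complete_ok v C D N -> [disjoint C & N] -> (g < #|C|)%N ->
  (g <= #|D :&: N|)%N -> (#|N| - g < #|core v C D|)%N ->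
  exists r A B N',
  [/\ near_complete_ok r A B N',
      has_profile (near_complete r A B N') (#|N| - g)
        (#|core v C D| - (#|N| - g)) 0 (#|V| - 1 - #|core v C D| - g) g 0,
      defect x r A B N' <= defect x v C D N &
      defect x r A B N' = defect x v C D N ->
      has_profile (near_complete v C D N) (#|N| - g)
        (#|core v C D| - (#|N| - g)) 0 (#|V| - 1 - #|core v C D| - g) g 0].
Proof.
move=> ok dCN gC gDN tk.
have /and4P [dCD vC vD vN] := ok.
have CN0 : C :&: N = set0 by apply/eqP; rewrite setI_eq0.
have cN := card_nbr_parts ok; rewrite CN0 cards0 addn0 in cN.
have cV := card_parts ok.
have gD : (g <= #|D|)%N by apply: leq_trans gDN _;
  apply/subset_leq_card/subsetIl.
have kg : (#|core v C D| + g < #|V|)%N by rewrite cV; move: gD; clear; lia.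
have wS := wt_core x ok.
have wN := wt_nbr_parts ok x; rewrite CN0 [wt x set0]big_set0 addr0 in wN.
have xv := x_gt0 v.
have wpos P : 0 <= wt x P by apply: wt_ge0 => u _; apply: ltW.
have /card_gt0P [z zC] : (0 < #|C|)%N by apply: leq_trans gC.
have wC := wtD1 x zC.
have gC' : (g <= #|C :\ z|)%N by move: gC; rewrite (cardsD1 z C) zC.
have coreN : wt x (core v C D :&: N) <= wt x (core v C D).
  by rewrite (wt_setID x (core v C D) N) lerDl.
have cT : (#|core v C D :&: N| <= #|N| - g)%N.
  by rewrite cN; move: gDN; clear; lia.
have [xvz|xzv] := lerP (x v) (x z).
  have [A [B [N' [ok' prof botB topF topN]]]] :=
    sorted_near_complete v kg (ltnW tk).
  exists v, A, B, N'.
  have wS' := wt_core x ok'.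
  have [D' D'DN cD'] := subset_of_card gDN.
  have D'D : D' \subset D by apply: subset_trans D'DN (subsetIl _ _).
  have D'N : D' \subset N by apply: subset_trans D'DN (subsetIr _ _).
  have wD := wt_setID x D D'; rewrite (setIidPr D'D) in wD.
  have wND := wt_setID x N D'; rewrite (setIidPr D'N) in wND.
  have b1 : wt x B <= wt x (C :\ z) by apply: botB;
    rewrite // !inE negb_and vC orbT.
  have b2 : wt x B <= wt x D'.
    by apply: botB; rewrite ?cD' //; apply: contra vD; apply: (subsetP D'D).
  have b3 : wt x (N :\: D') + wt x B <= wt x N'.
    apply: topN; first by rewrite inE negb_and vN orbT.
    by rewrite cardsD (setIidPr D'N) cD'.
  have b4 : wt x (core v C D) <= wt x (core v A B).
    by apply: topF => //; rewrite !inE eqxx.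
  have b5 := wpos (D :\: D'); have b6 := wpos B.
  (* The [g] vertices of [D'] are the neighbours of [v] to be replaced by [B]. The factor
     [wt x C - wt x B - x v] is nonnegative because [C :\ z] outweighs [B] and [z] pays for [v]. The
     extra term on the left forces [D = D'] in case of equality. *)
  have key : defect x v A B N' + x v * wt x (D :\: D') <= defect x v C D N.
    rewrite /defect -subr_ge0.
    have -> : wt x C * wt x D + x v * (wt x [set: V] - x v - wt x N)
       - (wt x A * wt x B + x v * (wt x [set: V] - x v - wt x N')
          + x v * wt x (D :\: D')) =
       (wt x C - wt x B - x v) * (wt x D - wt x B)
       + wt x B * (wt x C + wt x D - wt x A - wt x B)
       + x v * (wt x N' - wt x B - (wt x N - wt x D')
               + (wt x D - wt x D' - wt x (D :\: D'))) .
      move: (wt x C) (wt x D) (wt x A) (wt x B) (wt x N) (wt x N') (wt x D') (wt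
        x [set: V]) (wt x (D :\: D')).
      by move: (x v); clear => *; ring.
    rewrite !addr_ge0 ?mulr_ge0 ?(ltW xv) // ?subr_ge0.
    - by move: wC b1 xvz; clear; lra.
    - by move: wD b2 b5; clear; lra.
    - by move: wS wS' b4; clear; lra.
    - by move: b3 wND wD; clear; lra.
  split=> //.
    by apply: le_trans key; rewrite lerDl mulr_ge0 // ltW.
  move=> defE; have D0 : wt x (D :\: D') <= 0.
    by move: key; rewrite defE gerDl pmulr_rle0.
  have DE : D = D'.
    by apply: (@wt_sub_eq _ _ x) => //; rewrite wD gerDl.
  have := near_complete_profile_sub ok; rewrite DE cD'.
  have -> : #|C| = (#|V| - 1 - #|core v C D| - g)%N.
    by rewrite cV -cD' -DE; clear; lia.
  by rewrite -DE; apply; rewrite // DE.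
have zD : z \notin D.
  by apply/negP => zD; have := pred0P dCD z; rewrite /= zC zD.
have zF : z \notin core v C D by rewrite !inE zC orbT.
have [A [B [N' [ok' prof botB topF topN]]]] :=
  sorted_near_complete z kg (ltnW tk).
exists z, A, B, N'.
have wS' := wt_core x ok'.
have b1 : wt x B <= wt x (C :\ z) by apply: botB; rewrite // !inE eqxx.
have b2 : wt x B <= wt x D by apply: botB.
have b3 : wt x (core v C D :&: N) + wt x B <= wt x N'.
  by apply: topN => //; rewrite inE negb_and zF.
have b4 : wt x (core v C D) <= wt x (core z A B) by apply: topF.
have b5 : wt x (D :&: N) <= wt x D by rewrite (wt_setID x D N) lerDl.
have b6 := wpos B; have xz := x_gt0 z.
(* The strict bound [tk] leaves a core vertex that is not a neighbour of [v]. Together with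
   [x z < x v] it makes the exchange strict, so no equality case arises here. *)
have b7 : wt x (core v C D :&: N) < wt x (core v C D).
  rewrite (wt_setID x (core v C D) N) ltrDl wt_gt0 // cardsD subn_gt0.
  exact: leq_ltn_trans tk.
suff lt : defect x z A B N' < defect x v C D N.
  by split=> //; [exact: ltW | move=> defE; move: lt; rewrite defE ltxx].
rewrite /defect -subr_gt0.
set F := wt x (core v C D) in wS b4 b7 coreN *.
set T := wt x (core v C D :&: N) in wN b3 b7 coreN *.
set c := wt x (C :\ z) in wC b1 *.
have -> : wt x C * wt x D + x v * (wt x [set: V] - x v - wt x N)
   - (wt x A * wt x B + x z * (wt x [set: V] - x z - wt x N')) =
   (c - wt x B) * (wt x D + x v - wt x B - x z)
   + wt x B * (c + wt x D + x v - wt x A - wt x B)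
   + (x v - x z) * (F - T)
   + x v * (wt x D - wt x (D :&: N)) + x z * (wt x N' - T - wt x B).
  rewrite wS wC wN; move: (wt x D) (wt x A) (wt x B) (wt x N') (wt x (D :&: N)).
  by move: (c) (F) (T) (x v) (x z); clear => *; ring.
have q1 : 0 <= (c - wt x B) * (wt x D + x v - wt x B - x z).
  by rewrite mulr_ge0 ?subr_ge0 //; move: b2 xzv; clear; lra.
have q2 : 0 <= wt x B * (c + wt x D + x v - wt x A - wt x B).
  by rewrite mulr_ge0 ?subr_ge0 //; move: wS wS' wC b4; clear; lra.
have q3 : 0 < (x v - x z) * (F - T) by rewrite mulr_gt0 ?subr_gt0.
have q4 : 0 <= x v * (wt x D - wt x (D :&: N)).
  by rewrite mulr_ge0 ?subr_ge0 ?(ltW xv).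
have q5 : 0 <= x z * (wt x N' - T - wt x B).
  by rewrite mulr_ge0 ?(ltW xz) //; move: b3; clear; lra.
by rewrite ltr_wpDr // ltr_wpDr // ltr_wpDl // addr_ge0.
Qed.

End OutsideVertex.

(** * A cut consisting of the special vertex alone *)

Section CutVertex.
Variables (R : realType) (V : finType) (x : V -> R).
Hypothesis x_gt0 : forall u, 0 < x u.

(* B consists of a neighbour e of v on the lighter side and of the g lightest
   other vertices; keeping e as a neighbour of v makes N' meet both sides. *)
Lemma cut_vertex_bound (v : V) (C1 C2 N : {set V}) (g : nat) :
  near_complete_ok v C1 C2 N -> #|core v C1 C2| = 0%N ->
  (g < #|C1|)%N -> (g < #|C2|)%N -> (0 < #|C1 :&: N|)%N ->
  (0 < #|C2 :&: N|)%N -> (#|N| + g + 1 < #|V|)%N ->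
  wt x C2 <= wt x C1 ->
  exists A B N' : {set V},
  [/\ near_complete_ok v A B N',
      has_profile (near_complete v A B N') 0 0 (#|N| - 1)
        (#|V| - 1 - g - #|N|) 1 g,
      defect x v A B N' <= defect x v C1 C2 N &
      forall rho, 0 <= rho -> @eigenvec R (near_complete v A B N') rho x ->
        defect x v A B N' = defect x v C1 C2 N ->
        has_profile (near_complete v C1 C2 N) 0 0 (#|N| - 1)
          (#|V| - 1 - g - #|N|) 1 g].
Proof.
move=> ok c0 gC1 gC2 N1 /card_gt0P [e /setIP [eC2 eN]] dV w21.
have /and4P [dC vC1 vC2 vN] := ok.
have cV := card_parts ok; rewrite c0 addn0 in cV.
have [d dE] : exists d, d.+1 = #|N|.
  by exists #|N|.-1; rewrite prednK //; apply/card_gt0P; exists e.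
have [n2 n2E] : exists n2, n2.+2 = #|V|.
  exists #|V|.-2; rewrite cV; have : (0 < #|C1|)%N by apply: leq_ltn_trans gC1.
  by case: #|C1|.
rewrite -n2E -dE in dV *; rewrite !subn1 /=.
have -> : (n2.+1 - g - d.+1 = n2 - g - d)%N by clear; lia.
have ev : e != v by apply: contraNneq vN => <-.
(* The vertex [e] stays out of the sorting, since its weight is arbitrary while its role is
   prescribed. *)
pose W := ~: [set v; e].
have cW : #|W| = n2.
  have := cardsC [set v; e]; rewrite cards2 eq_sym ev -[RHS]n2E.
  by move=> [].
have inW u : (u \in W) = (u != v) && (u != e) by rewrite !inE negb_or.
have [pi [piW pic pix]] := decreasing_rank x W.
rewrite cW in piW pic.
have pv : (n2 <= pi v)%N by rewrite leqNgt -piW inW eqxx.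
have pe : (n2 <= pi e)%N by rewrite leqNgt -piW inW eqxx andbF.
have [p pE] : exists p, (p + g)%N = n2.
  by exists (n2 - g)%N; rewrite subnK //; move: dV; clear; lia.
have dp : (d <= p)%N by move: dV pE; clear; lia.
have pn : (p <= n2)%N by rewrite -pE leq_addr.
pose A := [set u | (0 <= pi u < p)%N].
pose B' := [set u | (p <= pi u < n2)%N].
pose T := [set u | (0 <= pi u < d)%N].
have eB' : e \notin B' by rewrite inE; clear -pe; lia.
have eT : e \notin T by rewrite inE; clear -pe dp pn; lia.
have vB' : v \notin B' by rewrite inE; clear -pv; lia.
have vT : v \notin T by rewrite inE; clear -pv dp pn; lia.
have vA : v \notin A by rewrite inE; clear -pv pn; lia.
have eA : e \notin A by rewrite inE; clear -pe pn; lia.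
have vB : v \notin e |: B' by rewrite in_setU1 negb_or eq_sym ev.
have vN' : v \notin e |: T by rewrite in_setU1 negb_or eq_sym ev.
have TA : T \subset A by apply/subsetP => u; rewrite !inE; clear -dp; lia.
have dAB' : A :&: B' = set0.
  by apply/setP => u; rewrite !inE; apply/negbTE; clear; lia.
have dTB' : B' :&: T = set0.
  by apply/setP => u; rewrite !inE; apply/negbTE; clear -dp; lia.
have dAB : [disjoint A & e |: B'].
  by rewrite -setI_eq0 setIUr dAB' setU0 setIC setI_eq0 disjoints1.
have ok' : near_complete_ok v A (e |: B') (e |: T).
  by rewrite /near_complete_ok dAB vA vB.
have cA : #|A| = p by rewrite pic ?subn0.
have cB' : #|B'| = g by rewrite pic ?pn ?leqnn // -pE addKn.
have cT : #|T| = d by rewrite pic ?subn0 //= (leq_trans dp).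
have cV' := card_parts ok'; rewrite -n2E cA cardsU1 eB' cB' in cV'.
have c0' : #|core v A (e |: B')| = 0%N.
  by move: cV'; rewrite -pE; clear; lia.
have x0 (P : {set V}) : forall u : V, u \in P -> 0 <= x u.
  by move=> u _; apply: ltW.
have prof' : has_profile (near_complete v A (e |: B') (e |: T)) 0 0 d
        (n2 - g - d) 1 g.
  have := near_complete_profile ok'.
  have eA0 : A :&: [set e] = set0.
    by apply/eqP; rewrite setIC setI_eq0 disjoints1.
  have -> : A :&: (e |: T) = T by rewrite setIUr (setIidPr TA) eA0 set0U.
  have -> : (e |: B') :&: (e |: T) = [set e] by rewrite -setUIr dTB' setU0.
  have cAD : #|A :\: (e |: T)| = (n2 - g - d)%N.
    by rewrite cardsD setIUr (setIidPr TA) eA0 set0U cA cT -pE addnK.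
  have cBD : #|(e |: B') :\: (e |: T)| = g.
    have d1 : [disjoint e |: B' & T].
      rewrite -setI_eq0 setIUl dTB' setU0 setI_eq0 disjoints1 //.
    by rewrite setDUr setU1K // (setDidPl d1) (setIidPl (subsetUr _ _)).
  rewrite cAD cBD cards1 cT.
  by rewrite (cards0_eq c0') set0I set0D cards0.
have wS := wt_core x ok; rewrite (cards0_eq c0) [wt x set0]big_set0 addr0 in wS.
have wS' := wt_core x ok';
  rewrite (cards0_eq c0') [wt x set0]big_set0 addr0 in wS'.
have wB : wt x (e |: B') = x e + wt x B' by apply: wtU1.
have wC2 := wtD1 x eC2.
have wN := wtD1 x eN.
have wN' : wt x (e |: T) = x e + wt x T by apply: wtU1.
have cC2 : #|C2| = (#|C2 :\ e|).+1 by rewrite (cardsD1 e C2) eC2.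
have cN : #|N :\ e| = d.
  by move: dE; rewrite (cardsD1 e N) eN => [[]].
have sepB' q1 q2 : q1 \in C2 :\ e -> q1 \notin B' -> q2 \in B' -> x q2 <= x q1.
  rewrite !inE => /andP [q1e q1C] q1B q2B.
  have q1v : q1 != v by apply: contraNneq vC2 => <-.
  have : q1 \in W by rewrite inW q1v q1e.
  move=> q1W; have := q1W; rewrite piW => q1n.
  by apply: pix; rewrite // ?piW; [clear -q2B | clear -q1B q1n q2B]; lia.
have b1 : wt x B' <= wt x (C2 :\ e).
  apply: (wt_le_sep _ (x0 _)) => [q1 q2 q1C q1B q2B _|].
    exact: sepB' q1C q1B q2B.
  by rewrite cB' -ltnS -cC2.
have inNW u : u \in N :\ e -> u \in W.
  rewrite inW in_setD1 => /andP [-> uN]; rewrite andbT.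
  by apply: contraNneq vN => <-.
have b2 : wt x (N :\ e) <= wt x T.
  apply: (wt_le_sep _ (x0 _)) => [q1 q2 q1T _ q2N|]; last by rewrite cN cT.
  move: q1T; rewrite !inE => q1T q2T.
  apply: pix; [by rewrite piW; clear -q1T dp pn; lia|exact: inNW|].
  by clear -q1T q2T; lia.
have xv := x_gt0 v.
have e1 : x v * (wt x [set: V] - x v - wt x (e |: T)) <=
    x v * (wt x [set: V] - x v - wt x N).
  by rewrite ler_pM2l // lerD2l lerN2 wN wN' lerD2l.
(* As [e] may be heavy, [B] need not be lighter than an arbitrary side. It is lighter than [C2],
   which also contains [e], and hence than [C1]; this is why [e] is taken on the lighter side. *)
have e2 : 0 <= (wt x C1 - wt x (e |: B')) * (wt x C2 - wt x (e |: B')).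
  by rewrite mulr_ge0 // subr_ge0; move: w21 b1 wB wC2; clear; lra.
have e3 : wt x C1 + wt x C2 - wt x A - wt x (e |: B') = 0.
  by move: wS wS'; clear; lra.
have e4 := defect_product (wt x C1) (wt x C2) (wt x A) (wt x (e |: B')).
rewrite e3 mulr0 addr0 in e4.
exists A, (e |: B'), (e |: T).
split=> //.
  by rewrite /defect lerD // -subr_ge0 e4.
move=> rho rho0 /(near_complete_eigen ok') xE defE.
have rho1 : 0 < rho + 1 by rewrite ltr_wpDl.
have cmp u w : (rho + 1) * x u < (rho + 1) * x w -> x u < x w
  by rewrite ltr_pM2l.
have [f1 f2] : wt x (e |: T) = wt x N /\
   (wt x C1 - wt x (e |: B')) * (wt x C2 - wt x (e |: B')) = 0.
  move: defE; rewrite /defect => defE.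
  split; last by move: defE e1 e2 e4; clear; lra.
  have : x v * (wt x [set: V] - x v - wt x (e |: T)) = x v * (wt x [set: V] - x
    v - wt x N).
    by move: defE e1 e2 e4; clear; lra.
  by move/(mulfI (lt0r_neq0 xv)); clear; lra.
have f3 : wt x C2 = wt x (e |: B').
  move: f2 => /eqP; rewrite mulf_eq0 !subr_eq0 => /orP [] /eqP //.
  by move: b1 w21 wB wC2; clear; lra.
have wBA : wt x (e |: B') <= wt x A.
  by move: e3 f3 w21; clear; lra.
have B0 : 0 < wt x (e |: B').
  by apply: wt_gt0 => //; apply/card_gt0P; exists e; rewrite setU11.
have sepT u w : u \in T -> w \in W -> w \notin T -> x w < x u.
  rewrite inW => uT /andP [wv we] wT; apply: cmp; rewrite !xE.
  have uA := subsetP TA _ uT.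
  have uv : (u == v) = false by apply/negbTE; apply: contraNneq vA => <-.
  have uB : (u \in e |: B') = false.
    apply/negbTE; have := pred0P dAB u; rewrite /= uA /= => ->.
    by [].
  rewrite uA uv uB (negPf wv) /= !in_setU1 uT orbT /= (negPf we) (negPf wT) /=.
  rewrite !mul0r !subr0 !mul1r.
  have [wA|wA] := boolP (w \in A).
    have -> : w \in B' = false.
      by apply/negbTE/negP => wB0; move/setP/(_ w): dAB';
        rewrite in_setI wA wB0 in_set0.
    by rewrite mul1r mul0r; move: xv; clear; lra.
  have wW : w \in W by rewrite inW wv we.
  have -> : w \in B'.
    by move: wW wA; rewrite piW !inE; clear; lia.
  by rewrite mul0r mul1r; move: xv wBA; clear; lra.
have NE : T = N :\ e.
  apply: (@wt_sep_eq _ _ x) => //; [|by rewrite cN cT|].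
    by move=> u w uT _ wNe wT; apply: sepT => //; apply: inNW.
  by move: f1 wN wN'; clear; lra.
have f4 : wt x (C2 :\ e) <= wt x B' by move: f3 wB wC2; clear; lra.
have cC2' : #|C2 :\ e| = g.
  rewrite -cB'; apply/esym; apply: (@wt_le_sep_card _ _ x) => //.
    by move=> q1 q2 q1C q1B q2B _; apply: sepB' q1C q1B q2B.
  by rewrite cB' -ltnS -cC2.
(* A vertex of [T] is strictly heavier than all of [B'], so [C2 :\ e] would outweigh [B']. Hence [e]
   is the only neighbour of [v] in [C2]. *)
have CT0 : (C2 :\ e) :&: T = set0.
  apply/setP => c; rewrite in_set0; apply/negbTE/negP => /setIP [cC cT'].
  have cB0 : c \notin B'.
    by apply/negP => cB0; move/setP/(_ c): dTB';
      rewrite in_setI cB0 cT' in_set0.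
  move: f4; rewrite leNgt => /negP; apply.
  apply: (@wt_lt_sep _ _ x _ _ c) => //.
  - by move=> q1 q2 q1C q1B q2B _; apply: sepB' q1C q1B q2B.
  - by rewrite cB' cC2'.
  - move=> q qB _; apply: sepT => //.
      by rewrite piW; move: qB; rewrite inE; clear; lia.
    by apply/negP => qT; move/setP/(_ q): dTB'; rewrite in_setI qB qT in_set0.
have C2N : C2 :&: N = [set e].
  apply/setP => u; rewrite in_setI in_set1; have [->|ue] := eqVneq u e.
    by rewrite eC2 eN.
  by move/setP/(_ u): CT0; rewrite NE !inE ue.
have cNN := card_nbr_parts ok;
  rewrite (cards0_eq c0) set0I cards0 C2N cards1 in cNN.
have c1N : #|C1 :&: N| = d by move: cNN; rewrite -dE add0n addn1 => [[]].
have := near_complete_profile ok.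
rewrite (cards0_eq c0) set0I set0D cards0 c1N C2N cards1.
have -> : #|C2 :\: N| = g.
  have := cardsID N C2; rewrite C2N cards1 cC2 cC2'; clear; lia.
have -> : #|C1 :\: N| = (n2 - g - d)%N.
  have := cardsID N C1; rewrite c1N; move: cV; rewrite -n2E cC2 cC2'.
  by move: #|C1| #|C1 :\: N|; clear; lia.
by [].
Qed.

End CutVertex.

(** * The strict move away from a special vertex in the cut *)

Section JoinedVertexNotOptimal.
Variables (R : realType) (V : finType).

(** [B] is a clique, and its indicator is the test vector in the Rayleigh bound. *)
Lemma spectral_radius_clique (r : V) (A B N : {set V}) g :
  near_complete_ok r A B N -> #|B| = g.+1 ->
  g%:R <= spectral_radius R (near_complete r A B N).
Proof.
move=> ok cB; have /and4P [dAB rA rB rN] := ok.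
have V0 : (0 < #|near_complete r A B N|)%N by apply/card_gt0P; exists r.
pose x u : R := (u \in B)%:R.
have := rayleigh (x : near_complete r A B N -> R) V0.
rewrite near_complete_quad //.
have wB (C : {set V}) : wt x C = #|C :&: B|%:R.
  rewrite -sum1_card natr_sum /wt [LHS]big_mkcond [RHS]big_mkcond.
  by apply: eq_bigr => u _; rewrite inE /x; do ![case: (_ \in _)].
have x2 : \sum_u x u ^+ 2 = g.+1%:R.
  rewrite -cB -[B in RHS]setTI -wB /wt; apply: eq_big => [u|u _].
    by rewrite inE.
  by rewrite /x; case: (_ \in _); rewrite ?expr1n ?expr0n.
have AB0 : A :&: B = set0 by apply/eqP; rewrite setI_eq0.
rewrite x2 /defect !wB setTI AB0 cards0 /x (negPf rB) !mul0r addr0 mulr0 subr0.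
rewrite cB -[g.+1%:R in X in X <= _]mul1r expr2 mul1r.
rewrite -[X in _ - X]mul1r -mulrBl ler_pM2r ?ltr0n //.
by rewrite -natr1 addrK.
Qed.

(* A vertex w of B is moved to the core, and the lighter one of r and w becomes
   the special vertex; the other one is then joined to everything but it. *)
Lemma joined_vertex_lt (r : V) (A B N : {set V}) (g : nat) :
  near_complete_ok r A B N -> #|B| = g.+1 -> [disjoint B & N] ->
  (g < #|A|)%N -> (#|A :&: N| <= g)%N -> (g <= #|N|)%N -> (0 < #|N|)%N ->
  exists2 H : sgraph,
    has_profile H (#|N| - g) (#|core r A B|.+1 - (#|N| - g)) 0 #|A| g 0 &
    spectral_radius R (near_complete r A B N) < spectral_radius R H.
Proof.
move=> ok cB dBN gA ANg gN N0.
have /and4P [dAB rA rB rN] := ok.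
have BN0 : B :&: N = set0 by apply/eqP; rewrite setI_eq0.
have V0 : (0 < #|near_complete r A B N|)%N by apply/card_gt0P; exists r.
have [y [yE y0 yn]] := perron R V0.
have rho_g := spectral_radius_clique ok cB.
set rho := spectral_radius R (near_complete r A B N) in yE rho_g *.
have eq_y := near_complete_eigen ok yE.
have /card_gt0P [w wB] : (0 < #|B|)%N by rewrite cB.
have wr : w != r by apply: contraNneq rB => <-.
have cN := card_nbr_parts ok; rewrite BN0 cards0 addn0 in cN.
have wN := wt_nbr_parts ok y; rewrite BN0 [wt y set0]big_set0 addr0 in wN.
have tC : (#|N| - g <= #|core r A B :&: N|)%N.
  by rewrite cN; move: ANg; clear; lia.
(* After the move the [g] vertices of [B :\ w] are neighbours of the special vertex, so only
   [#|N| - g] core neighbours are kept. The others form [L]. *)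
have [K KCN cK] := subset_of_card tC.
have KC : K \subset core r A B by apply: subset_trans KCN (subsetIl _ _).
have KN : K \subset N by apply: subset_trans KCN (subsetIr _ _).
pose L := (core r A B :&: N) :\: K.
have wKL := wt_setID y (core r A B :&: N) K.
rewrite (setIidPr KCN) -/L in wKL.
have cL : (#|L| + #|A :&: N|)%N = g.
  have := cardsID K (core r A B :&: N); rewrite (setIidPr KCN) -/L cK.
  by move: cN ANg gN; clear; lia.
have cAN : (#|L| < #|A :\: N|)%N.
  by have := cardsID N A; move: cL gA; clear; lia.
have wA := wt_setID y A N.
have wS := wt_core y ok.
have wBw := wtD1 y wB.
have wpos (P : {set V}) : 0 <= wt y P by apply: wt_ge0 => u _; apply: y0.
have cBw : #|B :\ w| = g by move: cB; rewrite (cardsD1 w B) wB => [[]].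
have rho0 : 0 <= rho by apply: le_trans rho_g.
have rho1 : 0 < rho + 1 by rewrite ltr_wpDl.
have /card_gt0P [a0] : (0 < #|A :\: N|)%N by apply: leq_ltn_trans cAN.
rewrite inE => /andP [a0N a0A].
have neq_r (P : {set V}) u : r \notin P -> u \in P -> (u == r) = false.
  by move=> rP uP; apply/negbTE; apply: contraNneq rP => <-.
have inB u : u \in A -> (u \in B) = false by move=> uA; have := pred0P dAB u;
  rewrite /= uA.
have inA u : u \in B -> (u \in A) = false.
  by move=> uB; have := pred0P dAB u; rewrite /= uB andbT.
have nBN u : u \in B -> (u \in N) = false.
  by move=> uB; have := pred0P dBN u; rewrite /= uB.
have yA a : a \in A -> a \notin N ->
    (rho + 1) * y a = wt y [set: V] - wt y B - y r.
  move=> aA aN; rewrite eq_y aA (inB _ aA) (neq_r _ _ rA aA) aN /=.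
  by rewrite !mul0r !subr0 !mul1r.
have yB b : b \in B -> (rho + 1) * y b = wt y [set: V] - wt y A - y r.
  move=> bB; rewrite eq_y bB (inA _ bB) (neq_r _ _ rB bB) (nBN _ bB) /=.
  by rewrite !mul0r !subr0 !mul1r.
have yAa a : a \in A :\: N -> y a = y a0.
  rewrite inE => /andP [aN aA]; apply: (mulfI (lt0r_neq0 rho1)).
  by rewrite !yA.
have yBw b : b \in B -> y b = y w.
  by move=> bB; apply: (mulfI (lt0r_neq0 rho1)); rewrite !yB.
have wBwE : wt y (B :\ w) = y w *+ g.
  rewrite -cBw -sumr_const; apply: eq_bigr => b; rewrite !inE => /andP [_].
  exact: yBw.
have wANE : wt y (A :\: N) = y a0 *+ #|A :\: N|.
  by rewrite -sumr_const; apply: eq_bigr => b; apply: yAa.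
have yC f : (rho + 1) * y f <= wt y [set: V].
  rewrite eq_y; have := wpos A; have := wpos B; have := y0 r.
  have := wpos (~: (r |: N)).
  have -> : wt y (~: (r |: N)) = wt y [set: V] - y r - wt y N.
    by have := wt_setID y [set: V] (~: (r |: N));
      rewrite setTI setTD setCK wtU1 //; lra.
  move: (wt y [set: V] - y r - wt y N) => M.
  move: (wt y [set: V]) (wt y A) (wt y B) (y r) => *.
  by rewrite -!addrA gerDl -!opprD oppr_le0 !addr_ge0 // mulr_ge0.
have wL : (rho + 1) * wt y L <= wt y [set: V] *+ #|L|.
  by rewrite mulr_sumr -sumr_const; apply: ler_sum => f _; apply: yC.
(* The factor [rho] is kept because it can be zero; it is cancelled only for [g > 0], where
   [rho >= g]. *)
have rho_r : rho * y r <= rho * y a0.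
  have -> : rho * y r = wt y N.
    apply/eqP; rewrite -(inj_eq (addIr (y r))) -[X in _ + X == _]mul1r -mulrDl.
    rewrite eq_y (negPf rA) (negPf rB) eqxx /= !mul0r !subr0 mul1r.
    by apply/eqP; ring.
  have := yA _ a0A a0N; rewrite mulrDl mul1r.
  have -> : wt y [set: V] - wt y B - y r = wt y (core r A B) + wt y A.
    by rewrite wS; ring.
  have : wt y (core r A B :&: N) <= wt y (core r A B).
    by rewrite (wt_setID y (core r A B) N) lerDl.
  have : y a0 <= wt y (A :\: N).
    by rewrite (@wtD1 _ _ y a0) ?lerDl // inE a0N.
  by move: wA wN; clear; lra.
(* [E] is the net gain per unit of weight of the new special vertex; the rest of the change in the
   defect is nonnegative because the lighter of [r] and [w] is chosen. *)
pose E := wt y (A :\: N) + wt y (B :\ w) - wt y L.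
(* [A :\: N] has more vertices than [L], all of weight [y a0], but those of [L] may be heavier, each
   by at most [(wt y B + y r) / (rho + 1)]. As [rho >= g] and [#|L| <= g], the total excess is at
   most [g * y w + g * y r / (g + 1)]. The first term is [wt y (B :\ w)]; the surplus vertex of
   [A :\: N] covers the second and leaves [y a0 / (g + 1)]. *)
have E_ge : y a0 <= g.+1%:R * E.
  have lc : wt y (A :\: N) >= y a0 *+ #|L|.+1.
    by rewrite wANE ler_wpMn2l.
  have Lg : (#|L| <= g)%N by rewrite -cL leq_addr.
  have gap : (rho + 1) * (wt y L - y a0 *+ #|L|) <= (y w *+ g.+1 + y r) *+ #|L|.
    have -> : y w *+ g.+1 = wt y B by rewrite wBw wBwE mulrS.
    have -> : wt y B + y r = wt y [set: V] - (rho + 1) * y a0 by rewrite yA //;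
      ring.
    by move: wL; rewrite mulrnBl mulrBr mulrnAr; clear; lra.
  have gap' : g.+1%:R * (wt y L - y a0 *+ #|L|) <= (y w *+ g.+1 + y r) *+ g.
    have [neg|pos] := lerP (wt y L - y a0 *+ #|L|) 0.
      apply: le_trans (_ : 0 <= _); first by rewrite mulr_ge0_le0.
      by rewrite mulrn_wge0 // addr_ge0 // mulrn_wge0.
    apply: (@le_trans _ _ ((rho + 1) * (wt y L - y a0 *+ #|L|))).
      by rewrite ler_wpM2r ?(ltW pos) // -natr1 lerD2r.
    by apply: le_trans gap _; rewrite ler_wpMn2l // addr_ge0 // mulrn_wge0.
  have yr : y r *+ g <= y a0 *+ g.
    have [->|g0] := posnP g; first by rewrite !mulr0n.
    rewrite ler_wMn2r // -(ler_pM2l (_ : 0 < rho)) //.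
    by apply: lt_le_trans rho_g; rewrite ltr0n.
  have lc' : 0 <= (g%:R + 1) * (wt y (A :\: N) - (y a0 + y a0 *+ #|L|)).
    by rewrite mulr_ge0 ?subr_ge0 -?mulrS // addr_ge0.
  rewrite /E wBwE; move: lc' gap' yr.
  rewrite -[y w *+ g]mulr_natl -[y r *+ g]mulr_natl -[y a0 *+ g]mulr_natl.
  rewrite -[(_ + _) *+ g]mulr_natl -[y w *+ g.+1]mulr_natl -natr1.
  move: (y a0 *+ #|L|) (wt y L) (wt y (A :\: N)) (y w) (y r) (y a0) (g%:R : R).
  by clear => *; lra.
have E0 : 0 <= E.
  by rewrite -(pmulr_rge0 _ (ltr0Sn R g)); apply: le_trans E_ge.
have /and4P [dAB' _ rBw _] : near_complete_ok r A (B :\ w) set0.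
  apply/and4P; split; rewrite ?inE ?(negPf rB) ?andbF //.
  by apply: disjointWr dAB; apply: subsetDl.
have wA' : w \notin A by rewrite (inA _ wB).
have dKA : K :&: A = set0.
  apply/setP => u; rewrite !inE; apply/negbTE/negP => /andP [uK uA].
  by have := subsetP KC _ uK; rewrite !inE uA orbT.
have dKB : K :&: B = set0.
  apply/setP => u; rewrite !inE; apply/negbTE/negP => /andP [uK uA].
  by have := subsetP KC _ uK; rewrite !inE uA orbT.
have rK : r \notin K by apply: contra rN; apply: (subsetP KN).
have wK : w \notin K.
  by apply/negP => wK; move/setP/(_ w): dKB; rewrite in_setI wK wB in_set0.
pose N' := K :|: B :\ w.
have dAN' : [disjoint A & N'].
  rewrite -setI_eq0 setIUr setIC dKA set0U; rewrite setI_eq0.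
  exact: dAB'.
have ok_r : near_complete_ok r A (B :\ w) N'.
  by rewrite /near_complete_ok dAB' rA rBw inE negb_or rK rBw.
have ok_w : near_complete_ok w A (B :\ w) N'.
  by rewrite /near_complete_ok dAB' wA' !inE negb_or wK eqxx.
have dKBw : [disjoint K & B :\ w].
  by apply: disjointWr (subsetDl _ _) _; rewrite -setI_eq0 dKB.
have cN' : #|N'| = #|N|.
  rewrite cardsU cK cBw; move: dKBw; rewrite -setI_eq0 => /eqP ->.
  by rewrite cards0 subn0 subnK.
have wN' : wt y N' = wt y K + wt y (B :\ w) by apply: wtU.
have cV := card_parts ok.
have core_card r' : near_complete_ok r' A (B :\ w) N' ->
    #|core r' A (B :\ w)| = #|core r A B|.+1.
  move=> /card_parts; rewrite {1}cV cB cBw; clear; lia.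
have prof r' : near_complete_ok r' A (B :\ w) N' ->
    has_profile (near_complete r' A (B :\ w) N') (#|N| - g)
      (#|core r A B|.+1 - (#|N| - g)) 0 #|A| g 0.
  move=> ok'; have := near_complete_profile_sub ok'.
  by rewrite (core_card _ ok') cBw cN'; apply => //; apply: subsetUr.
have conclude r' : near_complete_ok r' A (B :\ w) N' ->
    defect y r' A (B :\ w) N' <= defect y r A B N ->
    ((forall u, 0 < y u) -> defect y r' A (B :\ w) N' < defect y r A B N) ->
    rho < spectral_radius R (near_complete r' A (B :\ w) N').
  move=> ok' le_d lt_d.
  have subq (u v : near_complete r A B N) :
    adj u v -> near_complete_adj r A B N u v by [].
  have le_rho := @defect_spectral_radius R (near_complete r A B N) y r r'
    A B N A (B :\ w) N' ok ok' yE y0 yn subq le_d.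
  rewrite lt_neqAle le_rho andbT; apply/eqP => rhoE.
  have [y'E dE _] := @defect_spectral_radius_eq R (near_complete r A B N) y r r'
    A B N A (B :\ w) N' ok ok' yE y0 subq le_d rhoE.
  (* So far [y] is only nonnegative: with an empty core the original graph is disconnected. Equality
     would make [y] an eigenvector of the new graph, whose core contains one more vertex, so that it
     is connected and [y] is positive. *)
  have /card_gt0P [f fC] : (0 < #|core r' A (B :\ w)|)%N by rewrite core_card.
  have conn : connected (near_complete r' A (B :\ w) N').
    by apply: (near_complete_connected ok' fC); rewrite cN'.
  have y_gt0 := eigenvec_gt0 conn y'E y0 yn.
  by have := lt_d y_gt0; rewrite dE ltxx.
have coreKL : wt y (core r A B) =
    wt y K + wt y L + wt y (core r A B :\: N).
  by rewrite (wt_setID y (core r A B) N) wKL.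
have E_gt0 : (forall u, 0 < y u) -> 0 < E.
  by move=> yp; rewrite -(pmulr_rgt0 _ (ltr0Sn R g)); apply: lt_le_trans E_ge.
have [yrw|ywr] := lerP (y r) (y w).
  have dE : defect y r A B N - defect y r A (B :\ w) N' =
      (y w - y r) * wt y A + y r * E.
    rewrite /defect /E wN' wN wBw wKL wA.
    move: (wt y [set: V]) (wt y K) (wt y L) (wt y (A :&: N)) (wt y (A :\: N)).
    by move: (y r) (y w) (wt y (B :\ w)); clear => *; ring.
  exists (near_complete r A (B :\ w) N'); first exact: (prof _ ok_r).
  apply: (conclude _ ok_r) => [|yp].
    by rewrite -subr_ge0 dE addr_ge0 // mulr_ge0 // subr_ge0.
  rewrite -subr_gt0 dE ltr_wpDl //; last by rewrite mulr_gt0 // E_gt0.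
  by rewrite mulr_ge0 // subr_ge0.
have dE : defect y r A B N - defect y w A (B :\ w) N' =
    (y r - y w) * (wt y (core r A B :\: N) + wt y (A :\: N) + wt y (B :\ w))
    + y w * E.
  rewrite /defect /E wN' wN wS wBw coreKL wKL wA.
  move: (wt y K) (wt y L) (wt y (A :&: N)) (wt y (A :\: N)).
  move: (y r) (y w) (wt y (B :\ w)) (wt y (core r A B :\: N)).
  by clear => *; ring.
exists (near_complete w A (B :\ w) N'); first exact: (prof _ ok_w).
apply: (conclude _ ok_w) => [|yp].
  rewrite -subr_ge0 dE addr_ge0 //; last by rewrite mulr_ge0.
  by apply: mulr_ge0; [rewrite subr_ge0 ltW | rewrite !addr_ge0].
rewrite -subr_gt0 dE ltr_wpDl //; last by rewrite mulr_gt0 // E_gt0.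
by apply: mulr_ge0; [rewrite subr_ge0 ltW | rewrite !addr_ge0].
Qed.
End JoinedVertexNotOptimal.

Local Close Scope ring_scope.

(** * The extremal graphs and good neighbor cuts *)

Lemma card_ord_lt k p : p <= k -> #|[set i : 'I_k | i < p]| = p.
Proof.
move=> pk; transitivity (\sum_(i < k | i < p) 1).
  by rewrite -sum1_card; apply: eq_bigl => i; rewrite inE.
by rewrite (big_ord_narrow pk) sum1_card card_ord.
Qed.

Lemma card_ord_ge k p : p <= k -> #|[set i : 'I_k | ~~ (i < p)]| = k - p.
Proof.
move=> pk; have := cardsC [set i : 'I_k | i < p].
rewrite (card_ord_lt pk) card_ord => kE; rewrite -[X in X - p]kE addKn.
by apply: eq_card => i; rewrite !inE.
Qed.

Lemma card_sum_set (T1 T2 : finType) (P : pred (T1 + T2)) :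
  #|[set u | P u]| = #|[set a | P (inl a)]| + #|[set b | P (inr b)]|.
Proof.
rewrite -!sum1_card.
under eq_bigl do rewrite inE.
under [X in _ = X + _]eq_bigl do rewrite inE.
under [X in _ = _ + X]eq_bigl do rewrite inE.
by rewrite big_sumType.
Qed.

Lemma card_label_lt m p (c c' : option bool) e : p <= m ->
  #|[set i : 'I_m | Some (c', i < p) == Some (c, e) :> label]| =
  (c' == c) * (if e then p else m - p).
Proof.
move=> pm; have [->|cc] := eqVneq c' c; last first.
  rewrite mul0n; apply: eq_card0 => i; rewrite inE (inj_eq Some_inj) xpair_eqE.
  by rewrite (negPf cc).
rewrite mul1n; case: e;
  [rewrite -[RHS](card_ord_lt pm) | rewrite -[RHS](card_ord_ge pm)];
  by apply: eq_card => i; rewrite !inE (inj_eq Some_inj) xpair_eqE eqxx;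
    case: (i < p).
Qed.

Lemma card_set_const (T : finType) (b : bool) :
  #|[set _ : T | b]| = b * #|T|.
Proof.
case: b; last by rewrite mul0n; apply: eq_card0 => u; rewrite inE.
by rewrite mul1n -cardsT; apply: eq_card => u; rewrite !inE.
Qed.

Section TargetProfiles.

(** The added edges enter only through their values, so this covers all the extremal graphs built
    from a join and an extra vertex. *)
Lemma add_vertex_join_profile k a b p q s
    (E : rel (dunion (complete 1)
      (join (complete k) (dunion (complete a) (complete b))))) :
  p <= k -> q <= a -> s <= b ->
  (forall i j, E (inl i) (inr (inl j)) = (j < p)) ->
  (forall i j, E (inl i) (inr (inr (inl j))) = (j < q)) ->
  (forall i j, E (inl i) (inr (inr (inr j))) = (j < s)) ->
  (forall u v, E (inr u) v = false) ->
  has_profile (add_edges E) p (k - p) q (a - q) s (b - s).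
Proof.
move=> pk qa sb Ep Eq Es E0.
exists (fun u : ('I_1 + ('I_k + ('I_a + 'I_b)))%type => match u with
  | inl _ => None
  | inr (inl i) => Some (None, i < p)
  | inr (inr (inl i)) => Some (Some true, i < q)
  | inr (inr (inr i)) => Some (Some false, i < s)
  end); split=> [u v|t].
  rewrite /= /add_edges_adj.
  case: u => [i|[i|[i|i]]]; case: v => [j|[j|[j|j]]] //=;
    rewrite ?Ep ?Eq ?Es ?E0 ?andbF ?orbF ?andbT //=.
  by rewrite !ord1.
rewrite !card_sum_set card_set_const; case: t => [[c e]|] /=; last first.
  by rewrite !card_set_const !card_ord.
by rewrite !card_label_lt //; case: c => [[]|] /=; rewrite ?mul1n ?mul0n ?addn0.
Qed.

Lemma add_vertex_union_profile a b q s
    (E : rel (dunion (complete 1) (dunion (complete a) (complete b)))) :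
  q <= a -> s <= b ->
  (forall i j, E (inl i) (inr (inl j)) = (j < q)) ->
  (forall i j, E (inl i) (inr (inr j)) = (j < s)) ->
  (forall u v, E (inr u) v = false) ->
  has_profile (add_edges E) 0 0 q (a - q) s (b - s).
Proof.
move=> qa sb Eq Es E0.
exists (fun u : ('I_1 + ('I_a + 'I_b))%type => match u with
  | inl _ => None
  | inr (inl i) => Some (Some true, i < q)
  | inr (inr i) => Some (Some false, i < s)
  end); split=> [u v|t].
  rewrite /= /add_edges_adj.
  case: u => [i|[i|i]]; case: v => [j|[j|j]] //=;
    rewrite ?Eq ?Es ?E0 ?andbF ?orbF ?andbT //=.
  by rewrite !ord1.
rewrite !card_sum_set card_set_const; case: t => [[c e]|] /=; last first.
  by rewrite !card_set_const !card_ord.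
rewrite !card_label_lt //; case: c => [[]|] /=; rewrite ?mul1n ?mul0n ?addn0 //.
by case: e.
Qed.

(** No vertex is distinguished in this graph; [ord0] of the clique serves as the special vertex,
    adjacent to all others. *)
Lemma join_union_profile k a b :
  has_profile (join (complete k.+1) (dunion (complete a) (complete b)))
    k 0 a 0 b 0.
Proof.
exists (fun u : ('I_k.+1 + ('I_a + 'I_b))%type => match u with
  | inl i => if i == ord0 then None else Some (None, true)
  | inr (inl _) => Some (Some true, true)
  | inr (inr _) => Some (Some false, true)
  end); split=> [u v|t].
  case: u => [i|[i|i]]; case: v => [j|[j|j]] //=.
  - case i0: (i == ord0); case j0: (j == ord0) => /=; rewrite ?andbT ?andbF //.
    by rewrite (eqP i0) (eqP j0) eqxx.
  - by case: ifP.
  - by case: ifP.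
  - by case: ifP.
  - by rewrite eqxx andbT.
  - by case: ifP.
  - by rewrite eqxx andbT.
rewrite !card_sum_set !card_set_const !card_ord.
have cl : #|[set i : 'I_k.+1 | (if i == ord0 then None else Some (None, true))
    == t]| = match t with
      | None => 1 | Some (None, true) => k | _ => 0 end.
  case: t => [[[c|] e]|].
  - by apply: eq_card0 => i; rewrite inE; case: ifP.
  - case: e; last by apply: eq_card0 => i; rewrite inE; case: ifP.
    transitivity #|[set: 'I_k.+1] :\ ord0|.
      by apply: eq_card => i; rewrite !inE; case: (i == ord0).
    have := cardsD1 ord0 [set: 'I_k.+1].
    by rewrite cardsT card_ord inE => [[kE]]; apply: esym.
  - rewrite -[RHS](cards1 (ord0 : 'I_k.+1)); apply: eq_card => i; rewrite !inE.
    by case: (i == ord0).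
rewrite cl; case: t {cl} => [[[[]|] []]|] /=; rewrite ?mul1n ?mul0n ?addn0 //.
Qed.

End TargetProfiles.

Section Cut.
Variable G : sgraph.

Definition nbrs (v : G) : {set G} := [set w | adj v w].

Lemma connected_closed (S : {set G}) u : connected G -> u \in S ->
  (forall v w, v \in S -> adj v w -> w \in S) -> forall w, w \in S.
Proof.
move=> cG uS Sc w; have /connectP [p pP ->] : connect adj u w by apply: cG.
elim: p u uS pP => //= v p IH u uS /andP [uv]; apply: IH.
exact: Sc uS uv.
Qed.

(** [C1] is one component of the rest and [C2] the union of all others. Neighbours outside the cut
    stay on the same side, so the degree condition passes to each side. *)
Lemma good_neighbor_cut_parts g (F : {set G}) : good_neighbor_cut g F ->
  exists C1 C2 : {set G},
  [/\ [disjoint C1 & C2] /\ F = ~: (C1 :|: C2),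
      (0 < #|C1|) /\ (0 < #|C2|),
      forall u v, u \in C1 -> v \in C2 -> ~~ adj u v,
      forall u, u \in C1 -> g <= #|C1 :&: nbrs u| &
      forall u, u \in C2 -> g <= #|C2 :&: nbrs u|].
Proof.
move=> [ncF degF].
have [x [y xy]] : exists x y : delete F, ~~ connect adj x y.
  apply: boolp.contrapT => nxy; apply: ncF => x y;
    apply: boolp.contrapT => /negP xy.
  by apply: nxy; exists x, y.
pose C1 : {set G} := [set val z | z in [set z : delete F | connect adj x z]].
pose C2 : {set G} := [set val z | z in [set z : delete F | ~~ connect adj x z]].
have inC1 z : (val z \in C1) = connect adj x z.
  by rewrite mem_imset ?inE //; apply: val_inj.
have inC2 z : (val z \in C2) = ~~ connect adj x z.
  by rewrite mem_imset ?inE //; apply: val_inj.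
have step (z w : delete F) : adj z w -> connect adj x z = connect adj x w.
  have sc := sym_connect_sym (@adj_sym (delete F)).
  by move=> zw; apply: (same_connect_r sc); apply: connect1.
exists C1, C2; split.
- split.
    rewrite -setI_eq0; apply/eqP/setP => u; rewrite !inE; apply/negbTE/negP.
    by move=> /andP [/imsetP [z zC ->]]; move: zC; rewrite inC2 inE => ->.
  apply/setP => u; rewrite !inE negb_or.
  have [uF|uF] := boolP (u \in F).
    by apply/esym/andP; split; apply/negP => /imsetP [z _ uz];
      have := valP z; rewrite -uz uF.
  by have -> : u = val (Sub u uF : delete F) by []; rewrite inC1 inC2 andbN.
- by split; apply/card_gt0P; [exists (val x)|exists (val y)];
    rewrite ?inC1 ?inC2 ?connect0.
- move=> u v /imsetP [z + ->] /imsetP [w + ->]; rewrite !inE => xz xw.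
  by apply: contra xw => zw; rewrite -(step z w).
- move=> u /imsetP [z + ->]; rewrite inE => xz; apply: leq_trans (degF z) _.
  rewrite /deg -(card_imset _ val_inj); apply/subset_leq_card/subsetP => w.
  by move=> /imsetP [w' + ->]; rewrite in_setI inC1 /nbrs !inE => zw;
    rewrite -(step z w') ?xz.
- move=> u /imsetP [z + ->]; rewrite inE => xz; apply: leq_trans (degF z) _.
  rewrite /deg -(card_imset _ val_inj); apply/subset_leq_card/subsetP => w.
  by move=> /imsetP [w' + ->]; rewrite in_setI inC2 /nbrs !inE => zw;
    rewrite -(step z w') ?xz.
Qed.

End Cut.

(** * Extremality for each position of the special vertex *)

Section Extremal.
Variables (R : realType) (G : sgraph).
Hypothesis connG : connected G.

Lemma positive_perron (r : G) : exists x : G -> R,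
  eigenvec (spectral_radius R G) x /\ (forall u, (0 < x u)%R).
Proof.
have G0 : 0 < #|G| by apply/card_gt0P; exists r.
have [x [xE x0 xn]] := perron R G0.
by exists x; split=> //; apply: eigenvec_gt0 connG xE x0 xn.
Qed.

Section JoinedVertex.
Variables (r : G) (C1 C2 N : {set G}) (m : nat).
Hypothesis ok : near_complete_ok r C1 C2 N.
Hypothesis subG : forall u v : G, adj u v -> near_complete_adj r C1 C2 N u v.
Hypotheses (m0 : 0 < m) (mC1 : m <= #|C1|) (mC2 : m <= #|C2|).

Let k := #|core r C1 C2|.
Let d := #|N|.

(** Since [N'] avoids [B] and is nested with the core, it fills the core first and then overflows
    into [A]; the minimum covers both cases at once. *)
Lemma joined_vertex_counts (A B N' : {set G}) : near_complete_ok r A B N' ->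
  #|B| = m -> #|N'| = d -> #|core r A B| = k ->
  core r A B \subset N' \/ N' \subset core r A B -> [disjoint B & N'] ->
  [/\ #|A| = #|G| - 1 - k - m, #|core r A B :&: N'| = minn d k,
      #|A :&: N'| = d - minn d k & #|B :&: N'| = 0].
Proof.
move=> ok' cB cN ck sub; rewrite -setI_eq0 => /eqP BN.
have cV := card_parts ok'; have := card_nbr_parts ok'.
rewrite BN cards0 cN addn0 => dE.
have cF : #|core r A B :&: N'| = minn d k.
  case: sub => [s|s].
    have F : #|core r A B :&: N'| = k by rewrite (setIidPl s).
    by move: dE; rewrite F; clear; lia.
  have F : #|core r A B :&: N'| = d by rewrite (setIidPr s).
  by have := subset_leq_card s; rewrite F cN ck; clear; lia.
split=> //; last by move: dE; rewrite cF; clear; lia.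
by rewrite cV cB ck; move: #|A|; clear; lia.
Qed.

Lemma joined_vertex_extremal (H : sgraph) : d + m < #|G| ->
  has_profile H (minn d k) (k - minn d k) (d - minn d k)
    (#|G| - 1 - k - m - (d - minn d k)) 0 m ->
  rho_extremal R G H.
Proof.
move=> dm pH; have [x [xE x0]] := positive_perron r.
have [A [B [N' [ok' [cB cN ck sub dBN] le tight]]]] :=
  joined_vertex_bound x0 ok m0 mC1 mC2 (or_introl dm).
have [cA cF cAN cBN] := joined_vertex_counts ok' cB cN ck sub (dBN dm).
have xge u : (0 <= x u)%R by apply: ltW.
have xn : exists u, (x u != 0)%R by exists r; rewrite gt_eqF.
have rho0 := @spectral_radius_ge0 R (near_complete r A B N').
have G0 : 0 < #|G| by apply/card_gt0P; exists r.
have numbers : [/\ #|core r A B :\: N'| = k - minn d k,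
    #|A :\: N'| = #|G| - 1 - k - m - (d - minn d k) & #|B :\: N'| = m].
  by rewrite !cardsD cF cAN cBN ck cA cB subn0.
case: numbers => n1 n2 n3.
apply: (defect_rho_extremal ok ok' xE xge xn subG le x0 pH).
  by have := near_complete_profile ok'; rewrite cF cAN cBN n1 n2 n3.
move=> x'E dE; have := tight _ (rho0 G0) x'E dE.
by rewrite cF cAN cBN n1 n2 n3.
Qed.

Lemma full_vertex_extremal (H : sgraph) : d = #|G| - 1 ->
  has_profile H k 0 (#|G| - 1 - k - m) 0 m 0 ->
  rho_extremal R G H.
Proof.
move=> dm pH; have [x [xE x0]] := positive_perron r.
have [A [B [N' [ok' [cB cN ck _ _] le tight]]]] :=
  joined_vertex_bound x0 ok m0 mC1 mC2 (or_intror dm).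
have xge u : (0 <= x u)%R by apply: ltW.
have xn : exists u, (x u != 0)%R by exists r; rewrite gt_eqF.
have rho0 := @spectral_radius_ge0 R (near_complete r A B N').
have G0 : 0 < #|G| by apply/card_gt0P; exists r.
have /and4P [dAB rA rB rN'] := ok'.
have NE : N' = ~: [set r].
  apply/eqP; rewrite eqEcard; apply/andP; split.
    by apply/subsetP => u uN; rewrite !inE; apply: contraNneq rN' => <-.
  by rewrite cardsC1 cN -subn1 -dm.
have sub (S : {set G}) : r \notin S -> S \subset N'.
  by move=> rS; apply/subsetP => u uS; rewrite NE !inE;
    apply: contraNneq rS => <-.
have rF : r \notin core r A B by rewrite !inE eqxx.
have sI (S : {set G}) : r \notin S -> S :&: N' = S /\ S :\: N' = set0.
  by move=> /sub s; split; [apply/setIidPl | apply/eqP; rewrite setD_eq0].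
have [f1 f2] := sI _ rF; have [a1 a2] := sI _ rA; have [b1 b2] := sI _ rB.
have cA : #|A| = #|G| - 1 - k - m.
  by rewrite (card_parts ok') cB ck; move: #|A|; clear; lia.
apply: (defect_rho_extremal ok ok' xE xge xn subG le x0 pH).
  have := near_complete_profile ok'.
  by rewrite f1 f2 a1 a2 b1 b2 cards0 ck cA cB.
move=> x'E dE; have := tight _ (rho0 G0) x'E dE.
by rewrite f1 f2 a1 a2 b1 b2 cards0 ck cA cB.
Qed.

End JoinedVertex.

(** Sorting with a small part of size [g + 1] gives a graph to which the strict move applies, so [G]
    is never extremal here and the equality clause holds because both its sides fail. *)
Lemma joined_vertex_suboptimal (r : G) (C1 C2 N : {set G}) (g : nat) (H :
  sgraph) :
  near_complete_ok r C1 C2 N ->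
  (forall u v : G, adj u v -> near_complete_adj r C1 C2 N u v) ->
  g < #|C1| -> g < #|C2| -> #|N| + g.+1 < #|G| ->
  g <= #|N| -> 0 < #|N| -> #|N| <= g + #|core r C1 C2| ->
  has_profile H (#|N| - g) (#|core r C1 C2|.+1 - (#|N| - g)) 0
    (#|G| - 1 - #|core r C1 C2| - g.+1) g 0 ->
  rho_extremal R G H.
Proof.
move=> ok subG gC1 gC2 dm gN N0 Ng pH; have [x [xE x0]] := positive_perron r.
have [A [B [N' [ok' [cB cN ck sub dBN] le _]]]] :=
  joined_vertex_bound x0 ok (ltn0Sn g) gC1 gC2 (or_introl dm).
have [cA cF cAN cBN] := joined_vertex_counts ok' cB cN ck sub (dBN dm).
have xge u : (0 <= x u)%R by apply: ltW.
have xn : exists u, (x u != 0)%R by exists r; rewrite gt_eqF.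
have le_rho := defect_spectral_radius ok ok' xE xge xn subG le.
have gA : g < #|A|.
  rewrite cA (card_parts ok); move: gC1 gC2.
  by move: #|C1| #|C2| #|core r C1 C2|; clear; lia.
have ANg : #|A :&: N'| <= g by rewrite cAN; move: Ng gN; clear; lia.
have gN' : g <= #|N'| by rewrite cN.
have N0' : 0 < #|N'| by rewrite cN.
have [H' pH' lt] := joined_vertex_lt R ok' cB (dBN dm) gA ANg gN' N0'.
apply: rho_extremal_lt; apply: (Order.POrderTheory.le_lt_trans le_rho).
have iso : isomorphic H' H.
  by apply: profile_isomorphic pH' _; rewrite cN ck cA.
by rewrite -(isomorphic_spectral_radius R iso).
Qed.

Lemma outside_vertex_extremal (v : G) (C D N : {set G}) (g : nat) (H : sgraph) :
  near_complete_ok v C D N ->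
  (forall u w : G, adj u w -> near_complete_adj v C D N u w) ->
  [disjoint C & N] -> g < #|C| -> g <= #|D :&: N| ->
  #|N| - g < #|core v C D| ->
  has_profile H (#|N| - g) (#|core v C D| - (#|N| - g)) 0
    (#|G| - 1 - #|core v C D| - g) g 0 ->
  rho_extremal R G H.
Proof.
move=> ok subG dCN gC gD tk pH; have [x [xE x0]] := positive_perron v.
have [r [A [B [N' [ok' prof le tight]]]]] :=
  outside_vertex_bound x0 ok dCN gC gD tk.
have xge u : (0 <= x u)%R by apply: ltW.
have xn : exists u, (x u != 0)%R by exists v; rewrite gt_eqF.
by apply: (defect_rho_extremal ok ok' xE xge xn subG le x0 pH prof) => _.
Qed.

Lemma cut_vertex_extremal (v : G) (C1 C2 N : {set G}) (g : nat) (H : sgraph) :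
  near_complete_ok v C1 C2 N ->
  (forall u w : G, adj u w -> near_complete_adj v C1 C2 N u w) ->
  #|core v C1 C2| = 0 -> g < #|C1| -> g < #|C2| ->
  0 < #|C1 :&: N| -> 0 < #|C2 :&: N| -> #|N| + g + 1 < #|G| ->
  has_profile H 0 0 (#|N| - 1) (#|G| - 1 - g - #|N|) 1 g ->
  rho_extremal R G H.
Proof.
move=> ok subG c0 gC1 gC2 N1 N2 dm pH; have [x [xE x0]] := positive_perron v.
have xge u : (0 <= x u)%R by apply: ltW.
have xn : exists u, (x u != 0)%R by exists v; rewrite gt_eqF.
have G0 : 0 < #|G| by apply/card_gt0P; exists v.
wlog w21 : C1 C2 ok subG c0 gC1 gC2 N1 N2 / (wt x C2 <= wt x C1)%R.
  move=> W; have [w21|/ltW w12] := lerP (wt x C2) (wt x C1);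
    first exact: (W C1 C2).
  apply: (W C2 C1) => //.
  - by rewrite -near_complete_okC.
  - move=> u w /subG; rewrite /near_complete_adj.
    by case: (u != w) => //=; rewrite andbCA.
  - by rewrite coreC.
have [A [B [N' [ok' prof le tight]]]] :=
  cut_vertex_bound x0 ok c0 gC1 gC2 N1 N2 dm w21.
have rho0 := @spectral_radius_ge0 R (near_complete v A B N') G0.
apply: (defect_rho_extremal ok ok' xE xge xn subG le x0 pH prof).
exact: tight.
Qed.

End Extremal.

(** Taking [v] out of both sides makes this independent of the position of [v]; its own adjacencies
    are recorded by [nbrs v]. *)
Lemma cut_adj_near_complete (G : sgraph) (v : G) (C1 C2 : {set G}) :
  [disjoint C1 & C2] -> (forall a b, a \in C1 -> b \in C2 -> ~~ adj a b) ->
  forall u w : G, adj u w ->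
  near_complete_adj v (C1 :\ v) (C2 :\ v) (nbrs v) u w.
Proof.
move=> dC nC u w uw; apply/and5P; split.
- by apply: contraTneq uw => ->; rewrite adj_irr.
- by apply: contraTN uw => /andP [/setD1P [_ uC] /setD1P [_ wC]]; apply: nC.
- rewrite adj_sym in uw.
  by apply: contraTN uw => /andP [/setD1P [_ uC] /setD1P [_ wC]]; apply: nC.
- by apply/implyP => /eqP <-; rewrite inE.
- by apply/implyP => /eqP <-; rewrite inE adj_sym.
Qed.

Lemma nbrs_irr (G : sgraph) (v : G) : v \notin nbrs v.
Proof. by rewrite inE adj_irr. Qed.

Theorem theorem2 (R : realType) (n kappa delta g : nat) (G : sgraph) :
  kappa + 2 * (g + 1) <= n ->
  graph_class n kappa delta g G ->
  (* (I) *)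
  (delta < kappa -> delta < g ->
     rho_extremal R G (graph_delta_0 n kappa delta g)) /\
  (* (II) *)
  (g <= delta < kappa ->
     rho_extremal R G (graph_deltag_g n kappa delta g)) /\
  (* (III) *)
  (2 <= kappa -> kappa <= delta < g ->
     rho_extremal R G (graph_kappa1_deltakappa n kappa delta g)) /\
  (* (IV) *)
  (kappa = 1 -> kappa <= delta < g ->
     rho_extremal R G (graph_0_delta n delta g)) /\
  (* (V) *)
  (kappa <= delta -> g <= delta < g + kappa ->
     rho_extremal R G (graph_deltag_g n kappa delta g)) /\
  (* (VI) *)
  (g + kappa <= delta ->
     rho_extremal R G (graph_large_delta n kappa delta)).
Proof.
move=> ng [cG connG [[v dv] mind] [[F [cutF cF]] _]].
have [C1 [C2 [[dC FE] [C10 C20] nC n1 n2]]] := good_neighbor_cut_parts cutF.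
have cV : #|C1| + #|C2| + kappa = n.
  have := cardsC (C1 :|: C2); rewrite -FE cF cardsU.
  by move: dC; rewrite -setI_eq0 => /eqP ->; rewrite cards0 subn0 cG.
have dN : #|nbrs v| = delta by [].
have big (C : {set G}) : 0 < #|C| -> (forall u, u \in C ->
  g <= #|C :&: nbrs u|) ->
    g < #|C|.
  move=> /card_gt0P [u uC] /(_ u uC) gC; rewrite (cardsD1 u) uC ltnS.
  apply: leq_trans gC _; apply: subset_leq_card; apply/subsetP => w.
  rewrite !inE => /andP [-> uw]; rewrite andbT.
  by apply: contraTneq uw => ->; rewrite adj_irr.
have g1 : g < #|C1| by apply: big.
have g2 : g < #|C2| by apply: big.
have delta0 : 0 < delta.
  rewrite -dN; have /card_gt0P [u uv] : 0 < #|~: [set v]|.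
    by rewrite cardsC1 cG; move: ng; clear; lia.
  rewrite lt0n; apply/negP => /eqP N0.
  have : u \in [set v]; last by move: uv; rewrite !inE => /negPf ->.
  apply: (connected_closed connG (set11 v)) => a b /set1P -> vb.
  have : b \in nbrs v by rewrite inE.
  by rewrite (cards0_eq N0) in_set0.
have kappa0 : 0 < kappa.
  rewrite -cF lt0n cards_eq0; apply/eqP => F0.
  have /card_gt0P [u uC] := C10; have /card_gt0P [w wC] := C20.
  have : w \in C1.
    apply: (connected_closed connG uC) => a b aC ab.
    have := in_setT b; rewrite -setC0 -F0 FE setCK inE => /orP [//|bC].
    by move: ab; rewrite (negPf (nC _ _ aC bC)).
  by move=> wC1; have := pred0P dC w; rewrite /= wC1 wC.
have inside : v \in F -> [/\ near_complete_ok v C1 C2 (nbrs v),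
    forall u w : G, adj u w -> near_complete_adj v C1 C2 (nbrs v) u w &
    #|core v C1 C2| = kappa - 1].
  rewrite FE !inE negb_or => /andP [vC1 vC2].
  have ok : near_complete_ok v C1 C2 (nbrs v).
    by rewrite /near_complete_ok dC vC1 vC2 nbrs_irr.
  split=> //.
    have D1 (C : {set G}) : v \notin C -> C :\ v = C.
      by move=> vC; apply/setDidPl; rewrite disjoint_sym disjoints1.
    by have := cut_adj_near_complete v dC nC; rewrite !D1.
  by have := card_parts ok; rewrite cG -cV; clear; lia.
have outside : v \notin F -> exists C D : {set G},
  [/\ near_complete_ok v C D (nbrs v),
    forall u w : G, adj u w -> near_complete_adj v C D (nbrs v) u w,
    [disjoint C & nbrs v], g < #|C| & g <= #|D :&: nbrs v|] /\
    #|core v C D| = kappa.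
  rewrite FE inE negbK; move: C1 C2 dC {FE C10 C20} nC n1 n2 cV g1 g2 {inside}.
  have half (C D : {set G}) : [disjoint C & D] ->
      (forall a b, a \in C -> b \in D -> ~~ adj a b) ->
      (forall u, u \in D -> g <= #|D :&: nbrs u|) -> g < #|C| ->
      #|C| + #|D| + kappa = n -> v \in D -> exists C D : {set G},
      [/\ near_complete_ok v C D (nbrs v),
        forall u w : G, adj u w -> near_complete_adj v C D (nbrs v) u w,
        [disjoint C & nbrs v], g < #|C| & g <= #|D :&: nbrs v|] /\
        #|core v C D| = kappa.
    move=> dCD nCD nD gC cCD vD; exists C, (D :\ v).
    have vC : v \notin C.
      by apply/negP => vC; have := pred0P dCD v; rewrite /= vC vD.
    have ok : near_complete_ok v C (D :\ v) (nbrs v).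
      rewrite /near_complete_ok vC nbrs_irr !inE eqxx /= andbT.
      by apply: disjointWr dCD; apply: subsetDl.
    split; last first.
      by have := card_parts ok; rewrite cG -cCD (cardsD1 v D) vD; clear; lia.
    split=> //.
    - have CE : C :\ v = C by apply/setDidPl; rewrite disjoint_sym disjoints1.
      by have := cut_adj_near_complete v dCD nCD; rewrite CE.
    - rewrite -setI_eq0; apply/eqP/setP => a; rewrite !inE; apply/negbTE/negP.
      by move=> /andP [aC va]; have := nCD _ _ aC vD; rewrite adj_sym va.
    - apply: leq_trans (nD v vD) _; apply: subset_leq_card; apply/subsetP => a.
      rewrite !inE => /andP [-> va]; rewrite va !andbT.
      by apply: contraTneq va => ->; rewrite adj_irr.
  move=> C1 C2 dC nC n1 n2 cV g1 g2; rewrite inE => /orP [vC|vC].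
    apply: (half C2 C1) => //; first by rewrite disjoint_sym.
      by move=> a b aC bC; rewrite adj_sym nC.
    by rewrite [#|C2| + _]addnC.
  exact: (half C1 C2).
(* A vertex outside the cut keeps at least [g] neighbours, so a vertex of smaller degree must be in
   the cut. *)
have in_small : delta < g -> v \in F.
  move=> dg; apply: contraLR dg => /outside [C [D [[_ _ _ _ gD] _]]].
  rewrite -leqNgt -dN; apply: leq_trans gD _; apply: subset_leq_card.
  exact: subsetIr.
have caseII_V : g <= delta -> delta < g + kappa ->
    rho_extremal R G (graph_deltag_g n kappa delta g).
  move=> gd dgk.
  have prof : has_profile (graph_deltag_g n kappa delta g) (delta - g)
      (kappa - (delta - g)) 0 (n - g - 1 - kappa) g 0.
    rewrite -[X in has_profile _ _ _ _ X]subn0 -[X in has_profile _ _ _ _ _ _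
      X](subnn g).
    apply: add_vertex_join_profile => //.
    by move: dgk; clear; lia.
  have [/inside [ok subG ck]|/outside [C [D [[ok subG dCN gC gD] ck]]]] :=
    boolP (v \in F).
    apply: (joined_vertex_suboptimal R connG ok subG g1 g2);
      rewrite ?dN ?ck ?cG //.
    - by move: ng gd dgk; clear; lia.
    - by move: kappa0 dgk; clear; lia.
    - have -> : (kappa - 1).+1 = kappa by move: kappa0; clear; lia.
      have -> : n - 1 - (kappa - 1) - g.+1 = n - g - 1 - kappa.
        by move: kappa0; clear; lia.
      exact: prof.
  apply: (outside_vertex_extremal R connG ok subG dCN gC gD);
    rewrite ?dN ?ck ?cG //.
  - by move: gd dgk; clear; lia.
  - have -> : n - 1 - kappa - g = n - g - 1 - kappa by clear; lia.
    exact: prof.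
(* (I) and (III) differ only in whether the neighbourhood of [v] fits into the remaining [kappa - 1]
   vertices of the cut. *)
have caseI_III H : delta < g -> has_profile H (minn delta (kappa - 1))
    (kappa - 1 - minn delta (kappa - 1)) (delta - minn delta (kappa - 1))
    (n - g - 1 - kappa - (delta - minn delta (kappa - 1))) 0 (g + 1) ->
    rho_extremal R G H.
  move=> dg pH; have [ok subG ck] := inside (in_small dg).
  apply: (joined_vertex_extremal R connG ok subG (ltn0Sn g) g1 g2);
    rewrite ?dN ?ck ?cG.
    by move: ng dg; clear; lia.
  have -> : n - 1 - (kappa - 1) - g.+1 = n - g - 1 - kappa.
    by move: kappa0; clear; lia.
  by rewrite -[g.+1]addn1.
split; first move=> dk dg.
  apply: caseI_III => //.
  have -> : minn delta (kappa - 1) = delta by move: dk; clear; lia.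
  rewrite subnn -[X in has_profile _ _ _ _ _ _ X](subn0 (g + 1)).
  apply: add_vertex_join_profile => //.
  by move: dk; clear; lia.
split; first by move=> /andP [gd dk]; apply: caseII_V => //; move: dk; clear;
  lia.
split; first move=> k2 /andP [kd dg].
  apply: caseI_III => //.
  have -> : minn delta (kappa - 1) = kappa - 1 by move: kd; clear; lia.
  have -> : delta - (kappa - 1) = delta - kappa + 1.
    by move: kappa0 kd; clear; lia.
  rewrite -[X in has_profile _ _ _ _ _ _ X](subn0 (g + 1)).
  apply: add_vertex_join_profile => //.
  by move: ng dg kd; clear; lia.
split; first move=> k1 /andP [kd dg].
  have [ok subG ck] := inside (in_small dg).
  have FvE : F = [set v].
    by apply/esym/eqP; rewrite eqEcard sub1set in_small // cF cards1 k1.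
  have vC : v \notin C1 :|: C2 by rewrite -in_setC -FE in_small.
  (* A side without neighbours of the only cut vertex would be closed under adjacency, against
     connectedness. *)
  have meets (C D : {set G}) : C :|: D = C1 :|: C2 -> 0 < #|C| ->
      (forall a b, a \in C -> b \in D -> ~~ adj a b) -> 0 < #|C :&: nbrs v|.
    move=> CD /card_gt0P [u uC] nCD; rewrite lt0n; apply/negP => /eqP N0.
    have : v \in C; last by apply/negP; apply: contra vC; rewrite -CD inE => ->.
    apply: (connected_closed connG uC) => a b aC ab.
    have : b \in F :|: (C1 :|: C2) by rewrite FE setUC setUCr inE.
    rewrite FvE -CD !inE => /or3P [/eqP bv|//|bD].
      have : a \in C :&: nbrs v by rewrite !inE aC -bv adj_sym.
      by rewrite (cards0_eq N0) inE.
    by move: ab; rewrite (negPf (nCD _ _ aC bD)).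
  have m1 := meets C1 C2 erefl C10 nC.
  have m2 : 0 < #|C2 :&: nbrs v|.
    apply: (meets C2 C1) => //; first exact: setUC.
    by move=> a b aC bC; rewrite adj_sym nC.
  apply: (cut_vertex_extremal R connG ok subG _ g1 g2 m1 m2);
    rewrite ?dN ?ck ?cG ?k1 //.
    by move: ng dg; clear; lia.
  have -> : n - 1 - g - delta = n - g - 2 - (delta - 1).
    by move: delta0; clear; lia.
  rewrite -[X in has_profile _ _ _ _ _ _ X](addnK 1 g).
  apply: add_vertex_union_profile => //; last by rewrite addn1.
  by move: ng dg k1; clear; lia.
split; first by move=> kd /andP [gd dk]; apply: caseII_V.
move=> gkd; have /card_gt0P [r rF] : 0 < #|F| by rewrite cF.
have /norP [rC1 rC2] : ~~ ((r \in C1) || (r \in C2)).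
  by move: rF; rewrite FE !inE.
have ok : near_complete_ok r C1 C2 (~: [set r]).
  by rewrite /near_complete_ok dC rC1 rC2 !inE eqxx.
have subG (u w : G) : adj u w -> near_complete_adj r C1 C2 (~: [set r]) u w.
  move=> uw; have uw' : u != w by apply: contraTneq uw => ->; rewrite adj_irr.
  apply/and5P; split=> //.
  - by apply: contraTN uw => /andP [uC wC]; apply: nC.
  - by rewrite adj_sym in uw; apply: contraTN uw => /andP [uC wC]; apply: nC.
  - by apply/implyP => /eqP ur; rewrite !inE -ur eq_sym.
  - by apply/implyP => /eqP wr; rewrite !inE -wr.
have ck : #|core r C1 C2| = kappa - 1.
  by have := card_parts ok; rewrite cG -cV; clear; lia.
(* This is where the minimum degree enters (VI): the neighbours of a vertex of [C] lie in [C] and in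
   the [kappa] vertices of the cut. *)
have large (C D : {set G}) : F = ~: (C :|: D) -> 0 < #|C| ->
    (forall a b, a \in C -> b \in D -> ~~ adj a b) -> delta - kappa + 1 <= #|C|.
  move=> FCD /card_gt0P [u uC] nCD; rewrite (cardsD1 u) uC addn1 ltnS leq_subLR.
  apply: leq_trans (mind u) _; rewrite -cF.
  apply: (@leq_trans #|F :|: (C :\ u)|); last by rewrite cardsU leq_subr.
  apply: subset_leq_card; apply/subsetP => w; rewrite inE => uw.
  have wu : w != u by apply: contraTneq uw => ->; rewrite adj_irr.
  rewrite FCD !inE wu /=; have [wC|wC] := boolP (w \in C);
    first by rewrite orbT.
  by rewrite orbF; apply: contraTN uw => wD; apply: nCD.
have m1 : delta - kappa + 1 <= #|C1| by apply: (large C1 C2).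
have m2 : delta - kappa + 1 <= #|C2|.
  apply: (large C2 C1) => //; first by rewrite setUC.
  by move=> a b aC bC; rewrite adj_sym nC.
have m0 : 0 < delta - kappa + 1 by rewrite addn1.
apply: (full_vertex_extremal R connG ok subG m0 m1 m2).
  by rewrite cardsC1 -subn1.
rewrite ck cG.
have -> : n - 1 - (kappa - 1) - (delta - kappa + 1) = n - delta - 1.
  by move: kappa0 gkd; clear; lia.
move: kappa0; rewrite /graph_large_delta; clear; case: kappa => // k _.
by have -> : k.+1 - 1 = k; [rewrite subn1 | exact: join_union_profile].
Qed.
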